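(* Let $G=\mathrm{GL}_3(\mathbb{R})$ act on the space of skew-symmetric bilinear maps $\mathbb{R}^3\times\mathbb{R}^3\to\mathbb{R}^3$ as in the context, and for each Lie bracket below let $H\subseteq G$ be its stabilizer (automorphism group) and $B$ its $G$-orbit. In each case $H$ is a subgroup of the stabilizer of the unimodular part of the bracket, and the following holds. \begin{itemize} \item (Bianchi $V$; $[e_1,e_2]=0,\ [e_2,e_3]=-e_2,\ [e_3,e_1]=e_1$.) $$H=\left\{\begin{pmatrix}g_1&0\\c&1\end{pmatrix}\in\mathrm{GL}_3(\mathbb{R}):\ g_1\in\mathrm{GL}_2(\mathbb{R}),\ c\in\mathbb{R}^2\right\},$$ which is isomorphic to the affine group $\mathrm{Aff}_2(\mathbb{R})\cong\mathrm{GL}_2(\mathbb{R})\times_\sigma\mathbb{R}^2$ (semidirect product with respect to the obvious representation $\sigma$ of $\mathrm{GL}_2(\mathbb{R})$ on $\mathbb{R}^2$). The orbit $B_V$ has dimension $9-6=3$. The closure of $B_V$ contains, besides $B_V$ itself, only the orbit $B_I$ (the origin), and it equals the irreducible submodule $W_2=j((\mathbb{R}^3)^* )$. \item (Bianchi $IV$; $[e_1,e_2]=0,\ [e_2,e_3]=e_1-e_2,\ [e_3,e_1]=e_1$.) $$H=\left\{\begin{pmatrix}\mu&h_1&h_2\\0&\mu&0\\0&h_3&1\end{pmatrix}\in\mathrm{GL}_3(\mathbb{R}):\ \mu\in\mathbb{R}\setminus\{0\},\ h_1,h_2,h_3\in\mathbb{R}\right\},$$ which has dimension $4$, so $B_{IV}$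 has dimension $5$. The orbit $B_{II}$ has dimension $3$, and the map $q:B_{IV}\to B_{II}$ sending a bracket to its unimodular part has $2$-dimensional fibers which are affine subspaces of dimension $2$. In the closure of $B_{IV}$ there are $B_{IV}$, $B_{II}$, $B_V$ and $B_I$. \item (Bianchi $VI_h$, $h<0$; $[e_1,e_2]=0,\ [e_2,e_3]=e_1-he_2,\ [e_3,e_1]=he_1-e_2$.) The stabilizers are the same for all $h<0$, are of index $2$ in the stabilizer of Bianchi $VI_0$, and are given by $$H=\left\{\begin{pmatrix}g_1&c\\0&1\end{pmatrix}\in\mathrm{GL}_3(\mathbb{R}):\ g_1\in\mathrm{CO}(1,1),\ c\in\mathbb{R}^2\right\},$$ i.e. $H$ is a semidirect product $\mathrm{CO}(1,1)\times_\sigma\mathbb{R}^2$. All orbits $B_{VI_h}$ have dimension $5$, and $q:B_{VI_h}\to B_{VI_0}$ is a $2:1$ cover over the $5$-dimensional $B_{VI_0}$. In the closure of $B_{VI_h}$ one finds the orbits $B_{VI_h}$, $B_{II}$ and $B_I$ (and not $B_{IV}$ or $B_V$). However, $B_{IV}$, $B_V$ and $B_{VI_0}$ are in the closure of the union $\bigcup_{h<0}B_{VI_h}$. \item (Bianchi $VII_h$, $h>0$; $[e_1,e_2]=0,\ [e_2,e_3]=e_1-he_2,\ [e_3,e_1]=he_1+e_2$.) $$H=\left\{\begin{pmatrix}g_1&c\\0&1\end{pmatrix}\in\mathrm{GL}_3(\mathbb{R}):\ g_1\in\mathrm{CO}(2),\ c\in\mathbb{R}^2\right\}\cong\mathrm{CO}(2)\times_\sigma\mathbb{R}^2.$$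 The orbit $B_{VII_h}$ is $5$-dimensional, lies $2:1$ over $B_{VII_0}$ (via $q$), and has in its closure, besides itself, the orbits $B_{II}$ and $B_I$. The union $\bigcup_{h>0}B_{VII_h}$ is $6$-dimensional and has additionally the orbits $B_{IV}$, $B_V$ and $B_{VII_0}$ in its closure. \end{itemize}
   Context: $(e_1,e_2,e_3)$ is the canonical basis of $\mathbb{R}^3$. A matrix $g=(g^i_j)\in\mathrm{GL}_3(\mathbb{R})$ acts on $\mathbb{R}^3$ by $ge_j=\sum_i g^i_je_i$, and on skew-symmetric bilinear maps $C:\mathbb{R}^3\times\mathbb{R}^3\to\mathbb{R}^3$ (elements of $W=\Lambda^2(\mathbb{R}^3)^*\otimes\mathbb{R}^3$) by $(g.C)(a,b)=g\,C(g^{-1}a,g^{-1}b)$. The automorphism group of a Lie bracket is its stabilizer $H$, and its orbit carries the manifold structure of $G/H$, of dimension $9-\dim H$. For a Bianchi type $T$, $B_T\subseteq W$ denotes the orbit of the bracket of that type; closures are in the usual topology. For $\nu\in(\mathbb{R}^3)^*$ let $j(\nu)\in W$ be $j(\nu)(a,b)=\nu(a)b-\nu(b)a$, and $W_2=j((\mathbb{R}^3)^* )$. For $C\in W$ put $\nu_C(a)=\tfrac12\mathrm{tr}(b\mapsto C(a,b))$; the unimodular (tracefree) part of $C$ is $q(C)=C-j(\nu_C)$, and $q$ is $G$-equivariant. The unimodular types that occur are: Bianchi $I$ (zero bracket, so $B_I=\{0\}$); Bianchi $II$ ($[e_1,e_2]=0,\ [e_2,e_3]=e_1,\ [e_3,e_1]=0$);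 Bianchi $VI_0$ and $VII_0$ (the brackets of $VI_h$ and $VII_h$ in the claim with $h=0$). $\mathrm{CO}(1,1)=\{g_1\in\mathrm{GL}_2(\mathbb{R}):\exists\lambda\in\mathbb{R}\setminus\{0\},\ g_1\,\mathrm{diag}(1,-1)\,g_1^T=\lambda\,\mathrm{diag}(1,-1)\}$ and $\mathrm{CO}(2)=\{g_1\in\mathrm{GL}_2(\mathbb{R}):\exists\lambda\in\mathbb{R}\setminus\{0\},\ g_1g_1^T=\lambda I_2\}$, where $I_2$ is the $2\times2$ identity matrix. In the block matrices, the blocks have sizes $2$ and $1$, and $c$ is a row or column vector as the position requires.
   Formalization: In V, H consists of (g1 c; 0 1); in IV, h3 stands in position (2,3); in VI_h and VII_h, CO(1,1) and CO(2) are replaced by their index-2 subgroups with λ = det g1; the fibers of q on B_IV are affine planes through the point of B_II with that point removed. *)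

(* Defs.v *)
From HB Require Import structures.
From mathcomp Require Import all_boot all_order all_algebra.
From mathcomp Require Import all_classical all_reals all_analysis.
From mathcomp Require Import ring lra.

Set Implicit Arguments.
Unset Strict Implicit.
Unset Printing Implicit Defensive.

Import Order.TTheory GRing.Theory Num.Theory.
Import numFieldNormedType.Exports.

Local Open Scope classical_set_scope.
Local Open Scope ring_scope.

Section Topology.
Context {R : realType}.

Definition homeo_on (T U : topologicalType) (A : set T) (B : set U)
    (f : T -> U) : Prop :=
  {within A, continuous f} /\
  exists g : U -> T,
    [/\ {within B, continuous g},
        forall x, A x -> B (f x) /\ g (f x) = x
      & forall y, B y -> A (g y) /\ f (g y) = y].

(* f, not necessarily injective on A, is a covering A -> B with n sheets. *)
Definition covering (T U : topologicalType) (n : nat) (A : set T) (B : set U)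
    (f : T -> U) : Prop :=
  (forall x, A x -> B (f x)) /\
  forall y, B y -> exists (O : set U) (sheet : 'I_n -> set T),
    [/\ open O, O y,
        A `&` f @^-1` O = \bigcup_i sheet i,
        forall i j, i != j -> sheet i `&` sheet j = set0
      & forall i, (exists2 P : set T, open P & sheet i = A `&` P) /\
                  homeo_on (sheet i) (B `&` O) f].

(* Class C^n on an open subset D of a finite-dimensional space. *)
Fixpoint Cn_on (V V' : normedModType R) (n : nat) (D : set V) (f : V -> V')
    {struct n} : Prop :=
  match n with
  | 0 => forall x, D x -> {for x, continuous f}
  | n'.+1 => (forall x, D x -> differentiable f x) /\
             forall v, Cn_on n' D (fun x => 'D_v f x)
  end.

Definition smooth_on (V V' : normedModType R) (D : set V) (f : V -> V') :=
  forall n, Cn_on n D f.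

(* S is an embedded smooth k-dimensional submanifold of V: locally the
   homeomorphic image of an open subset of R^k under a smooth immersion. *)
Definition submanifold (V : normedModType R) (k : nat) (S : set V) : Prop :=
  forall x, S x -> exists (O : set V) (D : set 'rV[R]_k) (f : 'rV[R]_k -> V),
    [/\ open O /\ O x,
        open D,
        smooth_on D f,
        forall p, D p -> injective ('d f p)
      & homeo_on D (S `&` O) f].

(* Isomorphisms of groups given as subsets of a type with a product. *)
Definition group_iso (T U : Type) (A : set T) (mulA : T -> T -> T)
    (B : set U) (mulB : U -> U -> U) : Prop :=
  exists f : T -> U, set_bij A B f /\
    forall x y, A x -> A y -> f (mulA x y) = mulB (f x) (f y).

Definition top_group_iso (T U : topologicalType)
    (A : set T) (mulA : T -> T -> T) (B : set U) (mulB : U -> U -> U) : Prop :=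
  exists f : T -> U, homeo_on A B f /\
    forall x y, A x -> A y -> f (mulA x y) = mulB (f x) (f y).

End Topology.

Section MatrixGroups.
Context {R : realType}.

Definition GL n : set 'M[R]_n := [set g | g \in unitmx].

Definition is_subgroup n (H K : set 'M[R]_n) : Prop :=
  [/\ H `<=` K, H 1%:M,
      forall g g', H g -> H g' -> H (g *m g')
    & forall g, H g -> H (invmx g)].

Definition left_cosets n (H K : set 'M[R]_n) : set (set 'M[R]_n) :=
  [set [set g *m x | x in H] | g in K].

(* K x_sigma R^n, for the standard representation sigma of K `<=` GL n. *)
Definition sdprod_set n (K : set 'M[R]_n) : set ('M[R]_n * 'cV[R]_n) :=
  K `*` [set: 'cV[R]_n].

Definition sdprod_mul n (x y : 'M[R]_n * 'cV[R]_n) : 'M[R]_n * 'cV[R]_n :=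
  (x.1 *m y.1, x.2 + x.1 *m y.2).

Definition Aff n : set ('cV[R]_n -> 'cV[R]_n) :=
  [set f | exists g c, GL g /\ f = fun x => g *m x + c].

Definition CO (eta : 'M[R]_2) : set 'M[R]_2 :=
  [set g1 | GL g1 /\
            exists2 lam : R, lam != 0 & g1 *m eta *m g1^T = lam *: eta].

(* For eta = diag(1, -1) or 1%:M, an element of CO eta has lam = \det g1 or
   lam = - \det g1.  The former form a subgroup of index 2.  The latter, such as
   diag(1, -1), do not commute with the restriction of ad e3 to <e1, e2>, and
   for h <> 0 they do not extend to automorphisms of types VI_h and VII_h. *)
Definition COdet (eta : 'M[R]_2) : set 'M[R]_2 :=
  [set g1 | CO eta g1 /\ g1 *m eta *m g1^T = \det g1 *: eta].

Definition eta11 : 'M[R]_2 :=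
  \matrix_(i, j) (nth [::] [:: [:: 1; 0]; [:: 0; -1]] i)`_j.
Definition eta2 : 'M[R]_2 := 1%:M.

Definition affmx (x : 'M[R]_2 * 'cV[R]_2) : 'M[R]_3 :=
  (block_mx x.1 x.2 0 1%:M : 'M[R]_(2 + 1)).

Definition mx3 (rows : seq (seq R)) : 'M[R]_3 :=
  \matrix_(i, j) (nth [::] rows i)`_j.

End MatrixGroups.

Section SkewMaps.
Context {R : realType}.

Notation vec := 'cV[R]_3.
Notation W := 'M[R]_3.

Definition basis_vec (i : 'I_3) : vec := delta_mx i 0.

(* Indices in 'I_3 are added cyclically. *)
Definition cross (a b : vec) : vec :=
  \col_i (a (i + 1) 0 * b (i + 2) 0 - a (i + 2) 0 * b (i + 1) 0).

Definition skew_bilinear (f : vec -> vec -> vec) : Prop :=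
  (forall a, linear (f a)) /\ (forall a b, f a b = - f b a).

(* A skew-symmetric bilinear map f is stored as the 3 x 3 matrix whose columns
   are f(e2, e3), f(e3, e1), f(e1, e2); equivalently, f(a, b) is this matrix
   applied to a x b.  The lemmas brK, of_brK and br_skew_bilinear below say that
   this is a bijection. *)
Definition br (C : W) (a b : vec) : vec := C *m cross a b.

Definition of_br (f : vec -> vec -> vec) : W :=
  \matrix_(i, j) f (basis_vec (j + 1)) (basis_vec (j + 2)) i 0.

Definition act (g : 'M[R]_3) (C : W) : W :=
  of_br (fun a b => g *m br C (invmx g *m a) (invmx g *m b)).

Definition Stab (C : W) : set 'M[R]_3 := [set g | GL g /\ act g C = C].

Definition GLorbit (C : W) : set W := [set act g C | g in GL (n := 3)].

(* Dimension of the orbit of C, as the manifold G / Stab C. *)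
Definition orbit_dim (C : W) (k : nat) : Prop :=
  exists2 d : nat, submanifold d (Stab C) & (k + d = 9)%N.

Definition pairing (nu : 'rV[R]_3) (a : vec) : R := (nu *m a) 0 0.

Definition jmap (nu : 'rV[R]_3) : W :=
  of_br (fun a b => pairing nu a *: b - pairing nu b *: a).

Definition W2 : set W := range jmap.

Definition ad (C : W) (a : vec) : 'M[R]_3 := \matrix_(k, l) br C a (basis_vec l) k 0.

Definition nu_of (C : W) : 'rV[R]_3 := \row_i (2^-1 * \tr (ad C (basis_vec i))).

Definition unimod (C : W) : W := C - jmap (nu_of C).

Definition submodule (S : set W) : Prop :=
  [/\ S 0,
      forall x y, S x -> S y -> S (x + y),
      forall (t : R) x, S x -> S (t *: x)
    & forall g x, GL g -> S x -> S (act g x)].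

Definition irreducible_submodule (S : set W) : Prop :=
  [/\ submodule S, S <> [set 0]
    & forall S', submodule S' -> S' `<=` S -> S' = [set 0] \/ S' = S].

Definition affine_subspace (d : nat) (A : set W) : Prop :=
  exists (p : W) (v : d.-tuple W), free v /\
    A = [set p + \sum_(i < d) t i *: tnth v i | t in [set: 'I_d -> R]].

Definition mkbr (c12 c23 c31 : vec) : W :=
  \matrix_(i, k) ([:: c23; c31; c12]`_k) i 0.

Let e1 := basis_vec 0.
Let e2 := basis_vec 1.
Let e3 := basis_vec 2.

Definition bI : W := 0.
Definition bII : W := mkbr 0 e1 0.
Definition bIV : W := mkbr 0 (e1 - e2) e1.
Definition bV : W := mkbr 0 (- e2) e1.
Definition bVI (h : R) : W := mkbr 0 (e1 - h *: e2) (h *: e1 - e2).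
Definition bVII (h : R) : W := mkbr 0 (e1 - h *: e2) (h *: e1 + e2).

Lemma br_skew_bilinear (C : W) : skew_bilinear (br C).
Proof.
split=> [a t b c | a b].
  rewrite /br scalemxAr -mulmxDr; congr (_ *m _).
  by apply/colP => i; rewrite !mxE; ring.
by rewrite /br -mulmxN; congr (_ *m _); apply/colP => i; rewrite !mxE; ring.
Qed.

Lemma mkbrE (c12 c23 c31 : vec) :
  [/\ br (mkbr c12 c23 c31) e1 e2 = c12,
      br (mkbr c12 c23 c31) e2 e3 = c23
    & br (mkbr c12 c23 c31) e3 e1 = c31].
Proof.
by split; apply/colP => i; rewrite !mxE !big_ord_recl big_ord0 !mxE /=; ring.
Qed.

Lemma brK (C : W) : of_br (br C) = C.
Proof.
apply/matrixP => i k; rewrite !mxE !big_ord_recl big_ord0 !mxE.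
by case: k => [[|[|[|//]]] hk]; rewrite /= !(mulr0, mulr1, mul0r, oppr0,
  addr0, add0r, subr0); congr (C _ _); exact: val_inj.
Qed.

Lemma vecE (a : vec) : a = a 0 0 *: e1 + (a 1 0 *: e2 + a 2 0 *: e3).
Proof.
apply/colP => i; rewrite !mxE.
case: i => [[|[|[|//]]] hi]; rewrite /= ?(mulr0, mulr1, addr0, add0r);
  congr (a _ _); exact: val_inj.
Qed.

Lemma of_brK (f : vec -> vec -> vec) : skew_bilinear f -> br (of_br f) = f.
Proof.
move=> [flin fskew].
have fZD a x y t : f a (t *: x + y) = t *: f a x + f a y by exact: flin.
have f0 a : f a 0 = 0.
  by have := fZD a 0 0 (-1); rewrite scaler0 addr0 scaleN1r addNr.
have fZ a x t : f a (t *: x) = t *: f a x.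
  by rewrite -[t *: x]addr0 fZD f0 addr0.
have fD a b : f a b = a 0 0 *: f e1 b + (a 1 0 *: f e2 b + a 2 0 *: f e3 b).
  rewrite fskew {1}(vecE a) !fZD fZ !(fskew b) !scalerN -!opprD opprK.
  by [].
have fe x : f x x = 0.
  apply/eqP; have := fskew x x => /eqP; rewrite -addr_eq0 -mulr2n -scaler_nat.
  by rewrite scaler_eq0 pnatr_eq0.
apply/funext => a; apply/funext => b; apply/colP => i.
rewrite fD !(fskew _ b) !(fD b) !fe (fskew e2 e1) (fskew e3 e2) (fskew e1 e3).
rewrite !mxE !big_ord_recl big_ord0 !mxE.
have -> : (ord0 + 1 : 'I_3) = 1 by exact: val_inj.
have -> : (ord0 + 2 : 'I_3) = 2 by exact: val_inj.
have -> : (lift ord0 ord0 + 1 : 'I_3) = 2 by exact: val_inj.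
have -> : (lift ord0 ord0 + 2 : 'I_3) = 0 by exact: val_inj.
have -> : (lift ord0 (lift ord0 ord0) + 1 : 'I_3) = 0 by exact: val_inj.
have -> : (lift ord0 (lift ord0 ord0) + 2 : 'I_3) = 1 by exact: val_inj.
by rewrite -/e1 -/e2 -/e3; ring.
Qed.

End SkewMaps.

(* Main.v *)
(* A skew bilinear map is a 3 x 3 matrix C, on which g acts by
   C |-> (det g)^-1 g C g^T.  Write C = S + K with S symmetric (the unimodular
   part) and K skew (given by the covector nu).  All brackets involved have a
   normal form bstd a b c with a single upper left 2 x 2 block, and their orbits
   are cut out by polynomial conditions: S nu = 0, and nu nu^T is a multiple
   (eps h^2 with eps = -1, 1 for VI_h, VII_h) of the cofactor matrix of S.
   Conversely, if v^T S v <> 0 then s = S v and w = nu x v satisfy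
   (v^T S v) C = s s^T + (v x _)^T cof S (v x _) + (s w^T - w s^T),
   which exhibits C as a point of the orbit.  Closures follow: the polynomial
   conditions bound them from above, and one-parameter rescalings of (a, b, c)
   reach every limit orbit.  Stabilizers, fibers and the union of the B_VII_h are
   parametrized by polynomial maps with differentiable left inverses.  Finally nu
   is recovered from S up to sign as nu_i = +- |h| sqrt (eps (cof S)_ii), which
   makes S a double cover. *)
Require Import Defs.
From HB Require Import structures.
From mathcomp Require Import all_boot all_order all_algebra.
From mathcomp Require Import all_classical all_reals all_analysis.
From mathcomp Require Import ring lra.

Set Implicit Arguments.
Unset Strict Implicit.
Unset Printing Implicit Defensive.

Import Order.TTheory GRing.Theory Num.Theory.
Import numFieldNormedType.Exports.

Local Open Scope classical_set_scope.
Local Open Scope ring_scope.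

(** * The action in coordinates *)

(** The equations of a rank two orbit see h only through h^2: the half turn [refl3] reverses nu and
    keeps the symmetric normal form, so h and -h give the same orbit. This sign is the source both
    of the two sheets of [unimod] and of the index 2 of the stabilizers. Types VI_h and VII_h are
    handled together through eps^2 = 1; the sign of eps matters for the closure of the union of the
    VII_h, where h has to be eliminated and is recovered from the positivity of cof S. Matrices act
    on columns, and an automorphism fixes the covector nu = c e3^* when c <> 0. Hence it is the last
    row that is pinned to (0, 0, 1), and the translation vector stands in the last column, for types
    IV and V as well. The fibres over B_II are affine planes with one point removed: at that point
    nu = 0 and the bracket has type II. Each chart comes with a left inverse that is differentiable
    in the ambient matrix space; this yields the immersion property and the continuity of the
    inverse at once. *)

Lemma ord3P (P : 'I_3 -> Prop) : P 0 -> P 1 -> P 2 -> forall i, P i.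
Proof.
move=> P0 P1 P2 [[|[|[|//]]] lt_i3].
- by rewrite (_ : Ordinal _ = 0) //; exact: val_inj.
- by rewrite (_ : Ordinal _ = 1) //; exact: val_inj.
- by rewrite (_ : Ordinal _ = 2) //; exact: val_inj.
Qed.

Lemma sum3E (V : nmodType) (F : 'I_3 -> V) : \sum_i F i = F 0 + F 1 + F 2.
Proof.
rewrite !big_ord_recl big_ord0 addr0 addrA.
by congr (F _ + F _ + F _); exact: val_inj.
Qed.

Lemma ord3DE : ((0 + 1 = 1 :> 'I_3)%R * (0 + 2 = 2 :> 'I_3)%R *
  (1 + 1 = 2 :> 'I_3)%R * (1 + 2 = 0 :> 'I_3)%R * (2 + 1 = 0 :> 'I_3)%R *
  (2 + 2 = 1 :> 'I_3)%R)%type.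
Proof. by do !split; exact: val_inj. Qed.

Lemma ord3_eqE : (((0 == 1 :> 'I_3) = false)%R * ((0 == 2 :> 'I_3) = false)%R *
  ((1 == 0 :> 'I_3) = false)%R * ((1 == 2 :> 'I_3) = false)%R *
  ((2 == 0 :> 'I_3) = false)%R * ((2 == 1 :> 'I_3) = false)%R)%type.
Proof. by []. Qed.

Section Algebra.
Context {R : realType}.
Implicit Types (A C M S g : 'M[R]_3) (u v w : 'cV[R]_3) (a b c d h : R).

Definition cof3 M : 'M[R]_3 :=
  \matrix_(i, j) (M (i + 1) (j + 1) * M (i + 2) (j + 2) -
                  M (i + 1) (j + 2) * M (i + 2) (j + 1)).

Lemma det3E M : \det M =
  M 0 0 * (M 1 1 * M 2 2 - M 1 2 * M 2 1) - M 0 1 * (M 1 0 * M 2 2 - M 1 2 * M 2 0)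
  + M 0 2 * (M 1 0 * M 2 1 - M 1 1 * M 2 0).
Proof.
(* Entries indexed by [nat] let simplification evaluate the shifted indices of the minors. *)
have [F ->] : exists F : nat -> nat -> R, M = \matrix_(i, j) F i j.
  exists (fun i j => M (inord i) (inord j)).
  by apply/matrixP => i j; rewrite mxE !inord_val.
rewrite (expand_det_row _ 0) sum3E /cofactor.
rewrite !(expand_det_row _ ord0) !big_ord_recl !big_ord0 /cofactor !det_mx11 !mxE /=.
rewrite /bump /=; ring.
Qed.

(** Everything reduces to [cross] (A x) (A y) = cof A ([cross] x y), taken at A = g^-1, together
    with cof (g^-1) = g^T / det g. *)
Lemma actE g C : GL g -> act g C = (\det g)^-1 *: (g *m C *m g^T).
Proof.
rewrite /GL /= => gU.
have dg : \det g != 0 by rewrite -unitfE -unitmxE.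
(* The adjugate identity A (cof A)^T = det A for A = g^-1, solved for g. *)
have gV : g = \det g *: (cof3 (invmx g))^T.
  have : invmx g *m (cof3 (invmx g))^T = \det (invmx g) *: 1%:M.
    move: (invmx g) => A; rewrite det3E; apply/matrixP => i j.
    by rewrite !mxE sum3E !mxE; elim/ord3P: i; elim/ord3P: j;
       rewrite !ord3DE ?ord3_eqE ?eqxx ?mulr1n ?mulr0n; ring.
  move=> /(congr1 (mulmx g)); rewrite mulmxA mulmxV // mul1mx => ->.
  by rewrite -scalemxAr mulmx1 scalerA det_inv mulfV // scale1r.
have crossM A (x y : 'cV_3) : cross (A *m x) (A *m y) = cof3 A *m cross x y.
  apply/colP => i; rewrite !mxE !sum3E !mxE.
  by elim/ord3P: i; rewrite !ord3DE; ring.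
have gT : cof3 (invmx g) = (\det g)^-1 *: g^T.
  by rewrite {3}gV linearZ /= trmxK scalerA mulVf // scale1r.
rewrite -[RHS]brK; congr of_br; apply/funext => x; apply/funext => y.
by rewrite /br crossM gT -scalemxAl -!scalemxAr -scalemxAl !mulmxA.
Qed.


Lemma jmapE (nu : 'rV[R]_3) i j : jmap nu i j =
  nu 0 (j + 1) * (i == j + 2)%:R - nu 0 (j + 2) * (i == j + 1)%:R.
Proof.
rewrite !mxE /pairing !mxE !sum3E !mxE /=.
by elim/ord3P: i; elim/ord3P: j; rewrite !ord3DE ?ord3_eqE ?eqxx /=; ring.
Qed.

Lemma nu_ofE C i : nu_of C 0 i = (C (i + 1) (i + 2) - C (i + 2) (i + 1)) / 2.
Proof.
rewrite /nu_of mxE /mxtrace sum3E !mxE !sum3E !mxE.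
by elim/ord3P: i; rewrite !ord3DE ?ord3_eqE ?eqxx /=; field.
Qed.

Lemma unimodE C : unimod C = 2^-1 *: (C + C^T).
Proof.
apply/matrixP => i j; rewrite [LHS]mxE [X in _ + X]mxE jmapE !nu_ofE !mxE.
by elim/ord3P: i; elim/ord3P: j; rewrite !ord3DE ?ord3_eqE ?eqxx /=; field.
Qed.

Lemma unimodK C : C = unimod C + jmap (nu_of C).
Proof. by rewrite subrK. Qed.

Lemma tr_unimod C : (unimod C)^T = unimod C.
Proof. by rewrite unimodE linearZ linearD /= trmxK addrC. Qed.

Lemma unimod_act g C : GL g -> unimod (act g C) = act g (unimod C).
Proof.
move=> gU; rewrite !unimodE !actE // linearZ /= !trmx_mul trmxK -scalerDr.
by rewrite mulmxA -mulmxDl -mulmxDr -scalemxAr -scalemxAl !scalerA mulrC.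
Qed.

(** A trace form is natural, hence moves as a covector. With g kept on the left, invariance of nu
    under a stabilizer reads nu g = nu, a condition on the rows of g. *)
Lemma nu_of_act g C : GL g -> nu_of (act g C) *m g = nu_of C.
Proof.
move=> gU; have dg : \det g != 0 by rewrite -unitfE -unitmxE.
rewrite actE //; apply: (scalerI dg); apply/rowP => j.
rewrite [LHS]mxE [RHS]mxE [X in _ * X]mxE sum3E !nu_ofE !mxE !sum3E !mxE !sum3E.
rewrite [X in _ = X * _]det3E; move: dg; set d := \det g => dg.
by elim/ord3P: j; rewrite !ord3DE; field.
Qed.

Lemma nu_of_jmap (nu : 'rV[R]_3) : nu_of (jmap nu) = nu.
Proof.
apply/rowP => i; rewrite nu_ofE !jmapE.
by elim/ord3P: i; rewrite !ord3DE ?ord3_eqE ?eqxx /=; field.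
Qed.

Lemma W2E : W2 = [set C : 'M[R]_3 | unimod C = 0].
Proof.
apply/seteqP; split=> [_ [nu _ <-]|C /= SC0]; first by rewrite /= /unimod nu_of_jmap subrr.
by exists (nu_of C) => //; rewrite [RHS]unimodK SC0 add0r.
Qed.

Lemma act1 C : act 1%:M C = C.
Proof. by rewrite actE ?/GL/= ?unitmx1 // det1 invr1 scale1r trmx1 mulmx1 mul1mx. Qed.

Lemma actM g g' C : GL g -> GL g' -> act (g *m g') C = act g (act g' C).
Proof.
move=> gU g'U; rewrite !actE //; last by rewrite /GL/= unitmx_mul gU.
rewrite det_mulmx invfM trmx_mul -scalemxAr -scalemxAl scalerA !mulmxA.
by rewrite [_ * (\det g')^-1]mulrC.
Qed.

Lemma act_is_linear g : GL g -> linear (act g).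
Proof.
move=> gU t C D; rewrite !actE // mulmxDr mulmxDl scalerDr; congr (_ + _).
by rewrite -scalemxAr -scalemxAl !scalerA mulrC.
Qed.

Lemma act0 g : GL g -> act g 0 = 0.
Proof. by move=> gU; rewrite actE // mulmx0 mul0mx scaler0. Qed.

Lemma GLV g : GL g -> GL (invmx g).
Proof. by rewrite /GL /= unitmx_inv. Qed.

Lemma actK g C : GL g -> act (invmx g) (act g C) = C.
Proof. by move=> gU; rewrite -actM ?mulVmx ?act1 //; exact: GLV. Qed.

Lemma actVK g C : GL g -> act g (act (invmx g) C) = C.
Proof. by move=> gU; rewrite -actM ?mulmxV ?act1 //; exact: GLV. Qed.

Lemma GLorbit_refl C : GLorbit C C.
Proof. by exists 1%:M; rewrite ?act1 // /GL/= unitmx1. Qed.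

Lemma GLorbit_act g C D : GL g -> GLorbit C D -> GLorbit C (act g D).
Proof.
move=> gU [g' g'U <-]; exists (g *m g'); last by rewrite actM.
by rewrite /GL/= unitmx_mul gU.
Qed.

Lemma Stab_subgroup C C' : Stab C `<=` Stab C' -> is_subgroup (Stab C) (Stab C').
Proof.
split=> // [|g g' [gU gC] [g'U g'C]|g [gU gC]].
- by split; [rewrite /GL/= unitmx1 | rewrite act1].
- by split; [rewrite /GL/= unitmx_mul gU | rewrite actM // g'C].
- by split; [exact: GLV | rewrite -{1}gC actK].
Qed.

Lemma Stab_unimod C : Stab C `<=` Stab (unimod C).
Proof. by move=> g [gU gC]; split=> //; rewrite -unimod_act // gC. Qed.

Definition bstd a b c : 'M[R]_3 :=
  mx3 [:: [:: a; c; 0]; [:: - c; b; 0]; [:: 0; 0; 0]].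

(* g *m bstd a b c *m g^T is frame_br a b c of the first two columns of g. *)
Definition frame_br a b c u w : 'M[R]_3 :=
  a *: (u *m u^T) + b *: (w *m w^T) + c *: (u *m w^T - w *m u^T).

Lemma frame_brE a b c u w i j : frame_br a b c u w i j =
  a * (u i 0 * u j 0) + b * (w i 0 * w j 0) + c * (u i 0 * w j 0 - w i 0 * u j 0).
Proof. by rewrite !mxE !big_ord1 !mxE. Qed.

Lemma sqr_cV3_neq0 v : v != 0 -> v 0 0 ^+ 2 + v 1 0 ^+ 2 + v 2 0 ^+ 2 != 0.
Proof.
apply: contra_neq => /eqP; rewrite !paddr_eq0 ?addr_ge0 ?sqr_ge0 // !sqrf_eq0.
move=> /andP[/andP[/eqP v0 /eqP v1] /eqP v2]; apply/colP => i; rewrite mxE.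
by elim/ord3P: i.
Qed.

Lemma det_cols u w v :
  \det (\matrix_(i, j) [:: u i 0; w i 0; v i 0]`_j : 'M[R]_3) = ((cross u w)^T *m v) 0 0.
Proof. by rewrite det3E !mxE sum3E !mxE /= !ord3DE; ring. Qed.

(** The third column of g enters the action only through det g. Once u and w are independent, a
    suitable multiple of their cross product as third column realizes any nonzero determinant, so d
    is a free parameter. *)
Lemma GLorbit_bstd a b c : GLorbit (bstd a b c) =
  [set C | exists d u w, [/\ d != 0, cross u w != 0 & C = d^-1 *: frame_br a b c u w]].
Proof.
have frameg g : g *m bstd a b c *m g^T = frame_br a b c (col 0 g) (col 1 g).
  apply/matrixP => i j; rewrite frame_brE !mxE sum3E !mxE !sum3E !mxE /=; ring.
apply/seteqP; split=> [_ [g gU <-]|C /= [d [u [w [d0 uw0 ->]]]]].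
  rewrite actE // frameg; exists (\det g), (col 0 g), (col 1 g); split=> //.
    by rewrite -unitfE -unitmxE.
  apply/eqP => uw0; have := gU; rewrite /GL/= unitmxE unitfE => /eqP; apply.
  rewrite (_ : g = \matrix_(i, j) [:: col 0 g i 0; col 1 g i 0; col 2 g i 0]`_j).
    by rewrite det_cols uw0 trmx0 mul0mx mxE.
  by apply/matrixP => i j; rewrite mxE; elim/ord3P: j; rewrite /= mxE.
set n := cross u w; have n2 := sqr_cV3_neq0 uw0; set n2' := (X in X != 0) in n2.
(* The determinant is the scalar product of n = [cross u w] with the third column, so this multiple
   of n makes it equal to d. *)
pose g : 'M[R]_3 := \matrix_(i, j) [:: u i 0; w i 0; ((d / n2') *: n) i 0]`_j.
have dg : \det g = d.
  rewrite det_cols -/n -scalemxAr mxE -[RHS](divfK n2); congr (_ * _).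
  by rewrite mxE sum3E ![_^T _ _]mxE -!expr2.
exists g; first by rewrite /GL/= unitmxE unitfE dg.
rewrite actE ?/GL/= ?unitmxE ?unitfE ?dg // frameg.
by congr (_ *: frame_br _ _ _ _ _); apply/colP => i; rewrite !mxE.
Qed.

End Algebra.

(** * Normal forms and invariants of frame brackets *)

Section Orbits.
Context {R : realType}.
Implicit Types (A C M S g : 'M[R]_3) (u v w : 'cV[R]_3) (a b c d h : R).

Lemma bIIE : bII = bstd 1 0 0 :> 'M[R]_3.
Proof.
by apply/matrixP => i j; rewrite !mxE; elim/ord3P: i; elim/ord3P: j;
  rewrite /= !mxE ?ord3_eqE ?eqxx /=; ring.
Qed.

Lemma bIVE : bIV = bstd 1 0 1 :> 'M[R]_3.
Proof.
by apply/matrixP => i j; rewrite !mxE; elim/ord3P: i; elim/ord3P: j;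
  rewrite /= !mxE ?ord3_eqE ?eqxx /=; ring.
Qed.

Lemma bVE : bV = bstd 0 0 1 :> 'M[R]_3.
Proof.
by apply/matrixP => i j; rewrite !mxE; elim/ord3P: i; elim/ord3P: j;
  rewrite /= !mxE ?ord3_eqE ?eqxx /=; ring.
Qed.

Lemma bVIE h : bVI h = bstd 1 (-1) h.
Proof.
by apply/matrixP => i j; rewrite !mxE; elim/ord3P: i; elim/ord3P: j;
  rewrite /= !mxE ?ord3_eqE ?eqxx /=; ring.
Qed.

Lemma bVIIE h : bVII h = bstd 1 1 h.
Proof.
by apply/matrixP => i j; rewrite !mxE; elim/ord3P: i; elim/ord3P: j;
  rewrite /= !mxE ?ord3_eqE ?eqxx /=; ring.
Qed.

Lemma unimodZ t C : unimod (t *: C) = t *: unimod C.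
Proof. by rewrite !unimodE linearZ /= -scalerDr !scalerA mulrC. Qed.

Lemma unimod_frame_br a b c u w : unimod (frame_br a b c u w) = frame_br a b 0 u w.
Proof.
rewrite unimodE; apply/matrixP => i j.
by rewrite mxE [X in _ * X]mxE [X in _ + X]mxE !frame_brE; field.
Qed.

Lemma nu_of_frame_br d a b c u w :
  nu_of (d *: frame_br a b c u w) = (d * c) *: (cross u w)^T.
Proof.
apply/rowP => i; rewrite nu_ofE ![(_ *: frame_br _ _ _ _ _) _ _]mxE !frame_brE !mxE.
by elim/ord3P: i; rewrite !ord3DE; field.
Qed.

Lemma cof3_frame_br d a b u w :
  cof3 (d *: frame_br a b 0 u w) = (d ^+ 2 * (a * b)) *: (cross u w *m (cross u w)^T).
Proof.
apply/matrixP => i j.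
rewrite mxE ![(_ *: frame_br _ _ _ _ _) _ _]mxE !frame_brE !mxE !big_ord1 !mxE.
by elim/ord3P: i; elim/ord3P: j; rewrite !ord3DE; ring.
Qed.

(* Equivalent to the Jacobi identity for br C. *)
Definition jacobi C := unimod C *m (nu_of C)^T = 0.

Lemma jacobi_frame_br d a b c u w : jacobi (d *: frame_br a b c u w).
Proof.
rewrite /jacobi unimodZ unimod_frame_br nu_of_frame_br; apply/colP => i.
rewrite mxE sum3E ![(_ *: frame_br _ _ _ _ _) _ _]mxE !frame_brE !mxE !ord3DE.
by elim/ord3P: i; ring.
Qed.

(** Polarization: the values of the form at e_i and e_i + e_j determine all entries of a symmetric
    matrix. *)
Lemma ex_quad_neq0 S : S^T = S -> S != 0 -> exists v, (v^T *m S *m v) 0 0 != 0.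
Proof.
move=> Ssym S0; apply: contrapT => /forallNP q0.
have {}q0 v : \sum_i \sum_j v i 0 * S i j * v j 0 = 0.
  move: (q0 v) => /negP/negPn/eqP; rewrite -mulmxA mxE => q; rewrite -[RHS]q.
  apply: eq_bigr => i _; rewrite mxE [X in _ = _ * X]mxE mulr_sumr.
  by apply: eq_bigr => j _; rewrite mulrA.
move/eqP: S0; apply; apply/matrixP => i j; rewrite [RHS]mxE.
have Sx k l : S k l = S l k by rewrite -{1}Ssym mxE.
have := (q0 (delta_mx 0 0), q0 (delta_mx 1 0), q0 (delta_mx 2 0),
  q0 (delta_mx 0 0 + delta_mx 1 0), q0 (delta_mx 0 0 + delta_mx 2 0),
  q0 (delta_mx 1 0 + delta_mx 2 0)).
rewrite !sum3E !mxE /= ?ord3_eqE ?eqxx /= => -[[[[[]]]]].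
rewrite (Sx 1 0) (Sx 2 0) (Sx 2 1) => h1 h2 h3 h4 h5 h6.
by elim/ord3P: i; elim/ord3P: j; rewrite ?(Sx 1 0) ?(Sx 2 0) ?(Sx 2 1); lra.
Qed.

(* Cauchy-Binet for the quadratic form S: Q(v) Q(x) - B(v, x)^2 is the value of
   the adjugate of S on v x x. *)
Lemma quad_cof3 S v : S^T = S ->
  (v^T *m S *m v) 0 0 *: S =
  (S *m v) *m (S *m v)^T + jmap v^T *m cof3 S *m (jmap v^T)^T.
Proof.
move=> Ssym; have Sx k l : S k l = S l k by rewrite -{1}Ssym mxE.
apply/matrixP => i j; rewrite !(jmapE, mxE, sum3E, big_ord1) /=.
elim/ord3P: i; elim/ord3P: j; rewrite !ord3DE ?ord3_eqE ?eqxx /=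
 ?(Sx 1 0) ?(Sx 2 0) ?(Sx 2 1); ring.
Qed.
End Orbits.

(** * Frames built from the Jacobi condition *)

Section JacobiFrames.
Context {R : realType}.
Implicit Types (A C M S g : 'M[R]_3) (u v w : 'cV[R]_3) (a b c d h : R).

Lemma jmap_cross u w : jmap (cross u w)^T = u *m w^T - w *m u^T.
Proof.
apply/matrixP => i j; rewrite jmapE !(mxE, big_ord1) /=.
by elim/ord3P: i; elim/ord3P: j; rewrite !ord3DE ?ord3_eqE ?eqxx /=; ring.
Qed.

Lemma jmap_mulmx v w : jmap v^T *m w = cross w v.
Proof.
apply/colP => i; rewrite !(jmapE, mxE, sum3E).
by elim/ord3P: i; rewrite !ord3DE ?ord3_eqE ?eqxx /=; ring.
Qed.

Lemma cross_cross u v w :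
  cross u (cross v w) = (u^T *m w) 0 0 *: v - (u^T *m v) 0 0 *: w.
Proof.
apply/colP => i; rewrite !(mxE, sum3E).
by elim/ord3P: i; rewrite !ord3DE; ring.
Qed.

Lemma jmapZ t (nu : 'rV[R]_3) : jmap (t *: nu) = t *: jmap nu.
Proof. by apply/matrixP => i j; rewrite [RHS]mxE !jmapE !mxE; ring. Qed.

Lemma jmap0 : jmap (0 : 'rV[R]_3) = 0.
Proof. by rewrite -(scale0r (0 : 'rV_3)) jmapZ scale0r. Qed.

(** The double cross product gives s x (nu x v) = (s . v) nu - (s . nu) v, and s . nu = v^T S nu
    vanishes by Jacobi. So the skew part of q C is s w^T - w s^T, and [quad_cof3] supplies the
    symmetric part. *)
Lemma jacobi_frame C v (s := unimod C *m v) (w := cross (nu_of C)^T v)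
    (q := (v^T *m unimod C *m v) 0 0) : jacobi C ->
  cross s w = q *: (nu_of C)^T /\
  q *: C = s *m s^T + jmap v^T *m cof3 (unimod C) *m (jmap v^T)^T
           + (s *m w^T - w *m s^T).
Proof.
move=> jC; have cE : cross s w = q *: (nu_of C)^T.
  rewrite cross_cross /s trmx_mul tr_unimod -/q.
  by rewrite -(mulmxA _ _ (nu_of C)^T) jC mulmx0 mxE scale0r subr0.
split=> //; rewrite -jmap_cross cE linearZ /= trmxK jmapZ.
by rewrite -quad_cof3 ?tr_unimod // -scalerDr -unimodK.
Qed.

Lemma cross_ex u : u != 0 -> exists w, cross u w != 0.
Proof.
move=> u0; apply: contrapT => /forallNP c0.
have {}c0 i j : cross u (delta_mx i 0) j 0 = 0.
  by move/negP/negPn/eqP: (c0 (delta_mx i 0)) => ->; rewrite mxE.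
have := (c0 0 1, c0 1 2, c0 2 0); rewrite !mxE !ord3DE ?ord3_eqE /=.
move=> [[h2 h0] h1]; move/eqP: u0; apply; apply/colP => i; rewrite mxE.
by elim/ord3P: i; lra.
Qed.

Lemma crossZr u t w : cross u (t *: w) = t *: cross u w.
Proof. by apply/colP => i; rewrite !mxE; ring. Qed.

Lemma crossZl u t w : cross (t *: u) w = t *: cross u w.
Proof. by apply/colP => i; rewrite !mxE; ring. Qed.

Lemma frame_br_Zr a b c u t w :
  frame_br a b c u (t *: w) = frame_br a (b * t ^+ 2) (c * t) u w.
Proof. by apply/matrixP => i j; rewrite !frame_brE !mxE; ring. Qed.

Lemma frame_br_Zl a b c u t w :
  frame_br a b c (t *: u) w = frame_br (a * t ^+ 2) b (c * t) u w.
Proof. by apply/matrixP => i j; rewrite !frame_brE !mxE; ring. Qed.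

Lemma cross0l u : cross 0 u = 0.
Proof. by apply/colP => i; rewrite !mxE; ring. Qed.

Lemma trmx_neq0 m n (M : 'M[R]_(m, n)) : (M^T != 0) = (M != 0).
Proof. by rewrite -(inj_eq trmx_inj) trmx0 trmxK. Qed.

Lemma cov_sq_neq0 (nu : 'rV[R]_3) : nu != 0 -> nu^T *m nu != 0.
Proof.
move=> nu0; have [i nui] : exists i, nu 0 i != 0.
  apply: contrapT => /forallNP h; move/eqP: nu0; apply; apply/rowP => i.
  by move/negP/negPn/eqP: (h i) => ->; rewrite mxE.
apply: contraNneq nui => /matrixP/(_ i i)/eqP.
by rewrite !mxE big_ord1 mxE mulf_eq0 orbb.
Qed.

(** As w = [jmap] v^T nu^T, the hypothesis on nu^T nu turns the cofactor term of [jacobi_frame] into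
    a multiple of w w^T. Since nu <> 0 it also forces S <> 0, which provides v. *)
Lemma jacobi_rank2 C eps h : jacobi C -> eps ^+ 2 = 1 -> h != 0 -> nu_of C != 0 ->
  (nu_of C)^T *m nu_of C = (eps * h ^+ 2) *: cof3 (unimod C) ->
  GLorbit (bstd 1 eps h) C.
Proof.
move=> jC e2 h0 nu0 nuE; rewrite GLorbit_bstd /=.
have e0 : eps != 0 by apply: contra_eq_neq e2 => ->; rewrite expr0n /= eq_sym oner_neq0.
have S0 : unimod C != 0.
  apply: contraNneq (cov_sq_neq0 nu0) => S0; rewrite nuE S0.
  by apply/eqP/matrixP => i j; rewrite !mxE; ring.
have [v q0] := ex_quad_neq0 (tr_unimod C) S0.
have [cE CE] := jacobi_frame v jC; set q := (X in X != 0) in q0 cE CE.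
(* The factor h^-1 compensates the coefficient h of the skew part; then eps (w / h)(w / h)^T is
   eps^2 = 1 times the cofactor term. *)
exists q, (unimod C *m v), (h^-1 *: cross (nu_of C)^T v); split=> //.
  by rewrite crossZr cE !scaler_eq0 invr_eq0 (negPf h0) (negPf q0) /= trmx_neq0.
have wwT : cross (nu_of C)^T v *m (cross (nu_of C)^T v)^T =
    (eps * h ^+ 2) *: (jmap v^T *m cof3 (unimod C) *m (jmap v^T)^T).
  rewrite -jmap_mulmx trmx_mul trmxK mulmxA -(mulmxA (jmap _)) nuE.
  by rewrite -scalemxAr -scalemxAl.
rewrite frame_br_Zr mulfV // /frame_br scale1r -[C in LHS](scalerK q0) CE.
congr (_ *: (_ + _ + _)); last by rewrite scale1r.
rewrite wwT scalerA -[LHS]scale1r; congr (_ *: _); rewrite -e2; field; exact: h0.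
Qed.

(** With cof S = 0 the identity of [jacobi_frame] loses its middle term and becomes q C = s s^T + (s
    w^T - w s^T). *)
Lemma jacobi_IV C : jacobi C -> cof3 (unimod C) = 0 -> unimod C != 0 ->
  nu_of C != 0 -> GLorbit bIV C.
Proof.
move=> jC cof0 S0 nu0; rewrite bIVE GLorbit_bstd /=.
have [v q0] := ex_quad_neq0 (tr_unimod C) S0.
have [cE CE] := jacobi_frame v jC; set q := (X in X != 0) in q0 cE CE.
exists q, (unimod C *m v), (cross (nu_of C)^T v); split=> //.
  by rewrite cE scaler_eq0 (negPf q0) /= trmx_neq0.
rewrite -[C in LHS](scalerK q0) CE cof0 mulmx0 mul0mx /frame_br.
by rewrite !scale1r scale0r.
Qed.

(** Only q C = s s^T survives, so any w independent of s completes the frame. *)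
Lemma jacobi_II C : cof3 (unimod C) = 0 -> unimod C != 0 -> nu_of C = 0 ->
  GLorbit bII C.
Proof.
move=> cof0 S0 nu0; rewrite bIIE GLorbit_bstd /=.
have jC : jacobi C by rewrite /jacobi nu0 trmx0 mulmx0.
have [v q0] := ex_quad_neq0 (tr_unimod C) S0.
have [_] := jacobi_frame v jC; set q := (X in X != 0) in q0 *.
rewrite nu0 trmx0 cross0l cof0 trmx0 !(mulmx0, mul0mx) subr0 !addr0 => CE.
have s0 : unimod C *m v != 0.
  by apply: contraNneq q0; rewrite /q -mulmxA => ->; rewrite mulmx0 mxE.
have [w uw] := cross_ex s0; exists q, (unimod C *m v), w; split=> //.
by rewrite -[C in LHS](scalerK q0) CE /frame_br scale1r !scale0r !addr0.
Qed.

(** Without a quadratic form the frame comes from the Euclidean one: for p orthogonal to nu, p x (nu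
    x p) = |p|^2 nu. *)
Lemma jacobi_V C : unimod C = 0 -> nu_of C != 0 -> GLorbit bV C.
Proof.
move=> S0 nu0; rewrite bVE GLorbit_bstd /=.
have n0 : (nu_of C)^T != 0 by rewrite trmx_neq0.
have [v pn0] := cross_ex n0; set p := cross _ v in pn0.
have pn : (p^T *m (nu_of C)^T) 0 0 = 0.
  by rewrite !(mxE, sum3E) !ord3DE; ring.
have p2 : (p^T *m p) 0 0 != 0.
  by move: (sqr_cV3_neq0 pn0); rewrite [X in _ -> X != _]mxE sum3E ![p^T _ _]mxE -!expr2.
have cE : cross p (cross (nu_of C)^T p) = (p^T *m p) 0 0 *: (nu_of C)^T.
  by rewrite cross_cross pn scale0r subr0.
exists ((p^T *m p) 0 0), p, (cross (nu_of C)^T p); split=> //.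
  by rewrite cE scaler_eq0 (negPf p2) trmx_neq0.
rewrite /frame_br !scale0r !add0r scale1r -jmap_cross cE linearZ /= trmxK jmapZ.
by rewrite scalerK // [LHS]unimodK S0 add0r.
Qed.

End JacobiFrames.

(** * Polynomial equations of the orbits *)

Section OrbitEquations.
Context {R : realType}.
Implicit Types (A C M S g : 'M[R]_3) (u v w n : 'cV[R]_3) (a b c d h eps : R).

Lemma bstd_unimod a b c : unimod (bstd a b c) = bstd a b 0.
Proof.
apply/matrixP => i j; rewrite unimodE !mxE.
by elim/ord3P: i; elim/ord3P: j => /=; field.
Qed.

Lemma nu_of_unimod C : nu_of (unimod C) = 0.
Proof. by apply/rowP => i; rewrite nu_ofE unimodE !mxE addrC subrr mul0r. Qed.

Lemma unimod_nu0 C : nu_of C = 0 -> unimod C = C.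
Proof. by move=> nu0; rewrite [RHS]unimodK nu0 jmap0 addr0. Qed.

Lemma nu_ofD C D : nu_of (C + D) = nu_of C + nu_of D.
Proof. by apply/rowP => i; rewrite [RHS]mxE !nu_ofE !mxE -mulrDl; congr (_ / _); ring. Qed.

Lemma GLorbit_unimod C D : GLorbit C D -> GLorbit (unimod C) (unimod D).
Proof. by move=> [g gU <-]; exists g; rewrite ?unimod_act. Qed.

(** Here n is the cross product of the two frame vectors and d the inverse of the determinant. That
    nu is a multiple of n^T and cof S a multiple of n n^T is the source of all relations between
    them. *)
Lemma GLorbit_invariants a b c C : GLorbit (bstd a b c) C -> jacobi C /\
  exists d n, [/\ d != 0, n != 0, nu_of C = (d * c) *: n^T
    & cof3 (unimod C) = (d ^+ 2 * (a * b)) *: (n *m n^T)].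
Proof.
rewrite GLorbit_bstd => -[d [u [w [d0 n0 ->]]]]; split; first exact: jacobi_frame_br.
exists d^-1, (cross u w); rewrite invr_eq0 nu_of_frame_br unimodZ unimod_frame_br.
by rewrite cof3_frame_br.
Qed.

Lemma GLorbit_rank2 eps h : eps ^+ 2 = 1 -> h != 0 -> GLorbit (bstd 1 eps h) =
  [set C | [/\ jacobi C, nu_of C != 0 &
    (nu_of C)^T *m nu_of C = (eps * h ^+ 2) *: cof3 (unimod C)]].
Proof.
move=> e2 h0; apply/seteqP; split=> [C|C [jC nu0 nuE]]; last exact: jacobi_rank2.
move/GLorbit_invariants => [jC [d [n [d0 n0 nuE cofE]]]]; split=> //.
  by rewrite nuE scaler_eq0 mulf_eq0 (negPf d0) (negPf h0) trmx_neq0.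
rewrite nuE [(_ *: _)^T]linearZ /= trmxK -scalemxAl -scalemxAr !scalerA cofE scalerA.
by congr (_ *: _); rewrite mul1r -[LHS]mul1r -e2; ring.
Qed.

Lemma GLorbit_I : GLorbit bI = [set 0 : 'M[R]_3].
Proof.
apply/seteqP; split=> [_ [g gU <-]|_ ->]; first by rewrite act0.
exact: GLorbit_refl.
Qed.

Lemma GLorbit_V : GLorbit bV = [set C : 'M[R]_3 | unimod C = 0 /\ nu_of C != 0].
Proof.
apply/seteqP; split=> [C|C [S0 nu0]]; last exact: jacobi_V.
move=> BC; split.
  have [g gU <-] := BC; rewrite unimod_act // bVE bstd_unimod.
  rewrite (_ : bstd 0 0 0 = 0) ?act0 //; apply/matrixP => i j; rewrite !mxE.
  by elim/ord3P: i; elim/ord3P: j => /=; ring.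
move: BC; rewrite /= bVE => /GLorbit_invariants[_ [d [n [d0 n0 -> _]]]].
by rewrite scaler_eq0 mulr1 (negPf d0) trmx_neq0.
Qed.

Lemma bstd100_neq0 : bstd 1 0 0 != 0 :> 'M[R]_3.
Proof.
apply/eqP => /matrixP/(_ 0 0); rewrite !mxE /= => /eqP; exact/negP/oner_neq0.
Qed.

Lemma act_eq0 g C : GL g -> (act g C == 0) = (C == 0).
Proof.
move=> gU; apply/eqP/eqP => [g0|->]; last exact: act0.
by rewrite -(actK C gU) g0 act0 //; exact: GLV.
Qed.

Lemma GLorbit_II : GLorbit bII =
  [set C : 'M[R]_3 | [/\ nu_of C = 0, cof3 (unimod C) = 0 & unimod C != 0]].
Proof.
apply/seteqP; split=> [C BC|C [nu0 cof0 S0]]; last exact: jacobi_II.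
have [g gU CE] := BC; move: BC.
rewrite /= bIIE => /GLorbit_invariants[_ [d [n [_ _ -> ->]]]].
rewrite !mulr0 !scale0r -CE unimod_act // act_eq0 // bIIE bstd_unimod.
by split=> //; exact: bstd100_neq0.
Qed.

Lemma GLorbit_IV : GLorbit bIV = [set C : 'M[R]_3 |
  [/\ jacobi C, cof3 (unimod C) = 0, unimod C != 0 & nu_of C != 0]].
Proof.
apply/seteqP; split=> [C BC|C [jC cof0 S0 nu0]]; last exact: jacobi_IV.
have [g gU CE] := BC; move: BC.
rewrite /= bIVE => /GLorbit_invariants[jC [d [n [d0 n0 -> ->]]]]; split=> //.
- by rewrite !mulr0 scale0r.
- by rewrite -CE unimod_act // act_eq0 // bIVE bstd_unimod; exact: bstd100_neq0.
- by rewrite mulr1 scaler_eq0 (negPf d0) trmx_neq0.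
Qed.

(** The matrix (det S) S = cof (cof S) vanishes because cof S has rank one, so det S = 0. Then S cof
    S = (det S) 1 = 0, that is S n n^T = 0, and multiplying by n leaves S n = 0. *)
Lemma cof3_rank1_ker S t n : S^T = S -> cof3 S = t *: (n *m n^T) -> t != 0 ->
  n != 0 -> S *m n = 0.
Proof.
move=> Ssym cofE t0 n0; have Sx k l : S k l = S l k by rewrite -{1}Ssym mxE.
have dS : \det S *: S = cof3 (cof3 S).
  apply/matrixP => i j; rewrite det3E !mxE.
  by elim/ord3P: i; elim/ord3P: j; rewrite !ord3DE
    ?(Sx 1 0) ?(Sx 2 0) ?(Sx 2 1); ring.
have {dS} dS : \det S = 0.
  have : \det S *: S = 0.
    rewrite dS cofE; apply/matrixP => i j; rewrite !(mxE, big_ord1); ring.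
  by move/eqP; rewrite scaler_eq0 => /orP[/eqP//|/eqP->]; rewrite det0.
have : S *m cof3 S = 0.
  rewrite -[RHS](scale0r 1%:M) -dS det3E; apply/matrixP => i j.
  rewrite !mxE sum3E !mxE; elim/ord3P: i; elim/ord3P: j; rewrite !ord3DE
    ?ord3_eqE ?eqxx ?mulr1n ?mulr0n ?(Sx 1 0) ?(Sx 2 0) ?(Sx 2 1); ring.
rewrite cofE -scalemxAr => /eqP; rewrite scaler_eq0 (negPf t0) /= => /eqP Snn.
have n2 : (n^T *m n) 0 0 != 0.
  by move: (sqr_cV3_neq0 n0); rewrite [X in _ -> X != _]mxE sum3E ![n^T _ _]mxE -!expr2.
apply: (scalerI n2); rewrite scaler0.
have : S *m (n *m n^T) *m n = 0 by rewrite Snn mul0mx.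
by rewrite mulmxA -mulmxA {1}[n^T *m n]mx11_scalar mul_mx_scalar.
Qed.

(** The quadratic form of type VI_0 or VII_0 is lifted to a bracket with h = 1 by taking n^T as nu.
    The lift lies in a known orbit, and passing back to unimodular parts gives the claim. *)
Lemma GLorbit_rank2_unimod eps : eps ^+ 2 = 1 -> GLorbit (bstd 1 eps 0) =
  [set C | nu_of C = 0 /\
    exists2 n : 'cV_3, n != 0 & eps *: cof3 (unimod C) = n *m n^T].
Proof.
move=> e2; have e0 : eps != 0.
  by apply: contra_eq_neq e2 => ->; rewrite expr0n /= eq_sym oner_neq0.
apply/seteqP; split=> [C|C [nu0 [n n0 nE]]].
  move=> /GLorbit_invariants /= [jC [d [n [d0 n0 -> ->]]]]; rewrite mulr0 scale0r.
  split=> //; exists (d *: n); first by rewrite scaler_eq0 (negPf d0).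
  rewrite [(_ *: _)^T]linearZ /= -scalemxAl -scalemxAr !scalerA; congr (_ *: _).
  by rewrite mul1r -[RHS]mul1r -e2; ring.
have cofE : cof3 (unimod C) = eps^-1 *: (n *m n^T) by rewrite -nE scalerK.
have eV0 : eps^-1 != 0 by rewrite invr_eq0.
have Sn := cof3_rank1_ker (tr_unimod C) cofE eV0 n0.
(* The Jacobi condition for [C'] is S n = 0, just obtained from the rank one form of cof S. *)
pose C' := unimod C + jmap n^T.
have nuE : nu_of C' = n^T by rewrite nu_ofD nu_of_unimod nu_of_jmap add0r.
have SE : unimod C' = unimod C by rewrite {1}/unimod nuE addrK.
suff : GLorbit (bstd 1 eps 1) C'.
  by move/GLorbit_unimod; rewrite bstd_unimod SE unimod_nu0.
rewrite GLorbit_rank2 ?oner_neq0 //=; split.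
- by rewrite /jacobi SE nuE trmxK.
- by rewrite nuE trmx_neq0.
- by rewrite SE nuE trmxK expr1n mulr1.
Qed.

(** The third hypothesis is the vanishing of all 2 x 2 minors. If the diagonal were zero, A_ij^2 =
    A_ii A_jj would kill every entry; otherwise n is a column i divided by sqrt A_ii. *)
Lemma psd_rank1 A : A^T = A -> (forall i, 0 <= A i i) ->
  (forall i j k l, A i j * A k l = A i l * A k j) -> A != 0 ->
  exists2 n : 'cV_3, n != 0 & A = n *m n^T.
Proof.
move=> Asym Age0 Amin A0; have Ax k l : A k l = A l k by rewrite -{1}Asym mxE.
have [i Aii] : exists i, A i i != 0.
  apply: contrapT => /forallNP Aii; move/eqP: A0; apply; apply/matrixP => i j.
  have {}Aii k : A k k = 0 by apply/eqP; rewrite -[_ == _]negbK; exact/negP/Aii.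
  by have /eqP := Amin i j j i; rewrite !Aii mulr0 (Ax j i) mulf_eq0 orbb mxE => /eqP.
have s2 : Num.sqrt (A i i) ^+ 2 = A i i by rewrite sqr_sqrtr.
have AE : A = ((Num.sqrt (A i i))^-1 *: col i A) *m ((Num.sqrt (A i i))^-1 *: col i A)^T.
  apply/matrixP => k l; rewrite !(mxE, big_ord1) mulrACA -expr2 exprVn s2.
  by apply: (mulfI Aii); rewrite mulVKf // (Ax l i) Amin mulrC.
exists ((Num.sqrt (A i i))^-1 *: col i A) => //.
by apply: contraNneq A0 => n0; rewrite {}AE n0 mul0mx.
Qed.

Lemma tr_cof3 S : S^T = S -> (cof3 S)^T = cof3 S.
Proof.
move=> Ssym; have Sx k l : S k l = S l k by rewrite -{1}Ssym mxE.
by apply/matrixP => i j; rewrite !mxE !(Sx (j + _)); ring.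
Qed.

End OrbitEquations.

(** * Polynomial maps and charts *)

Section MatrixCalculus.
Context {R : realType}.

Lemma cvg_mx_entries (T : topologicalType) m n (f : T -> 'M[R]_(m, n)) x :
  (forall i j, {for x, continuous (fun t => f t i j)}) -> {for x, continuous f}.
Proof.
move=> fc A [P fxP PA]; apply: (@filterS _ (nbhs x) _ (fun t => forall i j, P i j (f t i j))).
  by move=> t tP; exact: PA.
apply: filter_forall => i; apply: filter_forall => j; exact: fc (fxP i j).
Qed.

Lemma differentiable_mx (V : normedModType R) m n (f : V -> 'M[R]_(m, n)) x :
  (forall i j, differentiable (fun t => f t i j) x) -> differentiable f x.
Proof.
move=> fd; have -> : f = \sum_i \sum_j (fun t => f t i j *: delta_mx i j).
  apply/funext => t; rewrite fct_sumE {1}[f t]matrix_sum_delta.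
  by apply: eq_bigr => i _; rewrite fct_sumE.
apply: differentiable_sum => i; apply: differentiable_sum => j.
exact: differentiableZl.
Qed.

(** A syntactic class stable under directional derivatives, so that [smooth_on] follows by induction
    on the order of differentiability. *)
Inductive polyfun m n : ('M[R]_(m, n) -> R) -> Prop :=
| polyfun_cst c : polyfun (fun=> c)
| polyfun_coord i j : polyfun (fun x => x i j)
| polyfunD f g : polyfun f -> polyfun g -> polyfun (fun x => f x + g x)
| polyfunM f g : polyfun f -> polyfun g -> polyfun (fun x => f x * g x).

Lemma eq_polyfun m n (f g : 'M[R]_(m, n) -> R) : f =1 g -> polyfun f -> polyfun g.
Proof. by move=> /funext ->. Qed.

Lemma polyfunN m n (f : 'M[R]_(m, n) -> R) : polyfun f -> polyfun (fun x => - f x).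
Proof.
move=> pf; rewrite (_ : (fun x => _) = fun x => (-1) * f x).
  by apply: polyfunM => //; exact: polyfun_cst.
by apply/funext => x; rewrite mulN1r.
Qed.

Lemma polyfunX m n (f : 'M[R]_(m, n) -> R) k : polyfun f -> polyfun (fun x => f x ^+ k).
Proof.
move=> pf; elim: k => [|k IH]; first exact: polyfun_cst.
rewrite (_ : (fun x => _) = fun x => f x * f x ^+ k); first exact: polyfunM.
by apply/funext => x; rewrite exprS.
Qed.

Lemma polyfun_sum m n (I : Type) (r : seq I) (f : I -> 'M[R]_(m, n) -> R) :
  (forall i, polyfun (f i)) -> polyfun (fun x => \sum_(i <- r) f i x).
Proof.
move=> pf; elim: r => [|i r IH].
  rewrite (_ : (fun x => _) = fun=> 0); first exact: polyfun_cst.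
  by apply/funext => x; rewrite big_nil.
rewrite (_ : (fun x => _) = fun x => f i x + \sum_(i <- r) f i x).
  exact: polyfunD.
by apply/funext => x; rewrite big_cons.
Qed.

Lemma polyfun_differentiable m n (f : 'M[R]_(m, n) -> R) x : polyfun f ->
  differentiable f x.
Proof.
elim=> {f} [c|i j|f g _ df _ dg|f g _ df _ dg].
- exact: differentiable_cst.
- exact: differentiable_coord.
- exact: differentiableD.
- exact: differentiableM.
Qed.

Lemma polyfun_continuous m n (f : 'M[R]_(m, n) -> R) : polyfun f -> continuous f.
Proof. by move=> pf x; exact/differentiable_continuous/polyfun_differentiable. Qed.

Lemma polyfun_derive m n (f : 'M[R]_(m, n) -> R) v : polyfun f ->
  polyfun (fun x => 'D_v f x).
Proof.
elim=> {f} [c|i j|f g pf dpf pg dpg|f g pf dpf pg dpg].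
- apply: (eq_polyfun (f := fun=> 0)); last exact: polyfun_cst.
  by move=> x; rewrite derive_cst.
- apply: (eq_polyfun (f := fun=> v i j)); last exact: polyfun_cst.
  move=> x; have dx : derivable (@id 'M[R]_(m, n)) x v by exact: derivable_id.
  by have /matrixP/(_ i j) := derive_mx dx; rewrite derive_id mxE.
- apply: (eq_polyfun (f := fun x => 'D_v f x + 'D_v g x)); last exact: polyfunD.
  by move=> x; rewrite -deriveD //; exact/diff_derivable/polyfun_differentiable.
- apply: (eq_polyfun (f := fun x => f x * 'D_v g x + g x * 'D_v f x)).
    by move=> x; rewrite -deriveM //; exact/diff_derivable/polyfun_differentiable.
  by apply: polyfunD; exact: polyfunM.
Qed.

Definition polymap m n p q (f : 'M[R]_(m, n) -> 'M[R]_(p, q)) :=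
  forall i j, polyfun (fun x => f x i j).

Lemma polymap_differentiable m n p q (f : 'M[R]_(m, n) -> 'M[R]_(p, q)) x :
  polymap f -> differentiable f x.
Proof. by move=> pf; apply: differentiable_mx => i j; exact/polyfun_differentiable/pf. Qed.

Lemma polymap_continuous m n p q (f : 'M[R]_(m, n) -> 'M[R]_(p, q)) :
  polymap f -> continuous f.
Proof. by move=> pf x; exact/differentiable_continuous/polymap_differentiable. Qed.

Lemma polymap_smooth m n p q (f : 'M[R]_(m, n) -> 'M[R]_(p, q)) D :
  polymap f -> smooth_on D f.
Proof.
move=> pf k; elim: k f pf => [|k IH] f pf /=; first by move=> x _; exact: polymap_continuous.
split=> [x _|v]; first exact: polymap_differentiable.
apply: IH => i j; apply: (eq_polyfun (f := fun x => 'D_v (fun x => f x i j) x)).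
  move=> x; rewrite derive_mx ?mxE //.
  exact/diff_derivable/polymap_differentiable.
exact: polyfun_derive.
Qed.

(** The chain rule applied to g o f, which is the identity near x since D is open, makes dg a left
    inverse of df. *)
Lemma diff_injective (V W : normedModType R) (D : set V) (f : V -> W) (g : W -> V) x :
  open D -> D x -> differentiable f x -> differentiable g (f x) ->
  (forall y, D y -> g (f y) = y) -> injective ('d f x).
Proof.
move=> oD Dx df dg gf.
have dgf v : 'd g (f x) ('d f x v) = v.
  have dc : differentiable (g \o f) x by exact: differentiable_comp.
  have := diff_comp df dg => /(congr1 (fun F => F v)) /= <-.
  rewrite -deriveE // -[RHS](derive_id x v); apply: near_eq_derive.
  by apply: filterS (open_nbhs_nbhs (conj oD Dx)) => y /gf.
by move=> v w fvw; rewrite -[v]dgf fvw dgf.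
Qed.

Lemma continuous_within_at (T U : topologicalType) (A : set T) (f : T -> U) :
  (forall x, A x -> {for x, continuous f}) -> {within A, continuous f}.
Proof.
by move=> fc; apply: continuous_in_subspaceT => x /set_mem; exact: fc.
Qed.

(** The map g is defined on all matrices and differentiable at the points of the image, not merely
    continuous on S. It is thus both the inverse required by [homeo_on] and the witness of injective
    differentials. *)
Definition chart m n k (S : set 'M[R]_(m, n)) (x : 'M[R]_(m, n)) :=
  exists (O : set 'M[R]_(m, n)) (D : set 'rV[R]_k) f g,
  [/\ open O, O x, open D & polymap f] /\
  [/\ forall p, D p -> differentiable g (f p),
      forall p, D p -> [/\ S (f p), O (f p) & g (f p) = p]
    & forall y, S y -> O y -> D (g y) /\ f (g y) = y].

Lemma chart_submanifold m n k (S : set 'M[R]_(m, n)) :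
  (forall x, S x -> chart k S x) -> submanifold k S.
Proof.
move=> Sch x /Sch [U [D [f [g [[oO Ox oD pf] [dg fg gf]]]]]].
exists U, D, f; split=> //; first exact: polymap_smooth.
  move=> p Dp; apply: (diff_injective oD Dp _ (dg p Dp)).
    exact: polymap_differentiable.
  by move=> y /fg[].
split; first by apply: continuous_within_at => y _; exact: polymap_continuous.
exists g; split.
- apply: continuous_within_at => y [Sy Oy]; have [Dgy <-] := gf y Sy Oy.
  exact/differentiable_continuous/dg.
- by move=> p /fg[].
- by move=> y [Sy Oy]; have [] := gf y Sy Oy.
Qed.

(** Polynomiality of F is phrased as stability of [polymap] under composition with F, which is
    checked directly for the linear maps it is applied to. *)
Lemma chart_image m n k (S : set 'M[R]_(m, n)) (F G : 'M[R]_(m, n) -> 'M[R]_(m, n)) x :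
  (forall p q (f : 'M[R]_(p, q) -> 'M[R]_(m, n)), polymap f -> polymap (F \o f)) ->
  polymap G -> cancel F G -> cancel G F -> chart k S x -> chart k (F @` S) (F x).
Proof.
move=> pF pG FK GK [U [D [f [g [[oO Ox oD pf] [dg fg gf]]]]]].
exists (G @^-1` U), D, (F \o f), (g \o G); split.
  split=> //; last exact: pF.
    by apply: open_comp => // y _; exact: polymap_continuous.
  by rewrite /= FK.
split=> [p Dp|p /fg[Sp Op gp]|_ [y Sy <-]] /=; rewrite ?FK.
- apply: differentiable_comp; first exact: polymap_differentiable.
  by rewrite /= FK; exact: dg.
- by split=> //; exists (f p).
- by move=> Oy; have [? ->] := gf y Sy Oy.
Qed.

End MatrixCalculus.

(** * Closures of orbits *)

Ltac polyt := repeat first [exact: polyfun_cst | exact: polyfun_coord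
  | apply: polyfunD | apply: polyfunN | apply: polyfunM | apply: polyfunX].

Section ClosureTools.
Context {R : realType}.
Implicit Types (A C M S g : 'M[R]_3) (u v w n : 'cV[R]_3) (a b c d h eps : R).

Lemma polyfun_unimod i j : polyfun (fun C : 'M[R]_3 => unimod C i j).
Proof.
apply: (eq_polyfun (f := fun C => 2^-1 * (C i j + C j i))); last by polyt.
by move=> C; rewrite unimodE !mxE.
Qed.

Lemma polyfun_nu_of i j : polyfun (fun C : 'M[R]_3 => nu_of C i j).
Proof.
apply: (eq_polyfun (f := fun C => (C (j + 1) (j + 2) - C (j + 2) (j + 1)) / 2)); last by polyt.
by move=> C; rewrite (ord1 i) nu_ofE.
Qed.

Lemma polyfun_cof3_unimod i j : polyfun (fun C : 'M[R]_3 => cof3 (unimod C) i j).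
Proof.
apply: (eq_polyfun (f := fun C =>
  unimod C (i + 1) (j + 1) * unimod C (i + 2) (j + 2) -
  unimod C (i + 1) (j + 2) * unimod C (i + 2) (j + 1))).
  by move=> C; rewrite !mxE.
by polyt; exact: polyfun_unimod.
Qed.

Lemma closure_polyfun_eq (B : set 'M[R]_3) (f g : 'M[R]_3 -> R) : polyfun f -> polyfun g ->
  (forall C, B C -> f C = g C) -> forall C, closure B C -> f C = g C.
Proof.
move=> pf pg fg C BC; apply/subr0_eq.
have pfg : polyfun (fun C => f C - g C) by polyt.
have cl0 : closed ((fun C => f C - g C) @^-1` [set 0]).
  by apply: closed_comp; [move=> x _; exact: polyfun_continuous | exact: closed_eq].
apply: (cl0 C); apply: closureS BC => D /fg /=; move=> ->; exact: subrr.
Qed.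

Lemma closure_polyfun_ge0 (B : set 'M[R]_3) (f : 'M[R]_3 -> R) : polyfun f ->
  (forall C, B C -> 0 <= f C) -> forall C, closure B C -> 0 <= f C.
Proof.
move=> pf f0 C BC.
have cl0 : closed (f @^-1` [set x | 0 <= x]).
  by apply: closed_comp; [move=> x _; exact: polyfun_continuous | exact: closed_ge].
by apply: (cl0 C); apply: closureS BC => D /f0.
Qed.

Lemma polyfun_tr_nu_of i j k l :
  polyfun (fun C : 'M[R]_3 => nu_of C i j * nu_of C k l).
Proof. by polyt; exact: polyfun_nu_of. Qed.

Lemma closure_jacobi (B : set 'M[R]_3) : B `<=` [set C | jacobi C] ->
  forall C, closure B C -> jacobi C.
Proof.
move=> Bj C BC; apply/matrixP => i j; rewrite [RHS]mxE.
apply: (closure_polyfun_eq (f := fun C => (unimod C *m (nu_of C)^T) i j) _ _ _ BC).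
- apply: (eq_polyfun (f := fun C => \sum_k unimod C i k * nu_of C j k)).
    by move=> D; rewrite [RHS]mxE; apply: eq_bigr => k _; rewrite [X in _ = _ * X]mxE.
  by apply: polyfun_sum => k; polyt; [exact: polyfun_unimod | exact: polyfun_nu_of].
- exact: polyfun_cst.
- by move=> D /Bj jD; rewrite jD mxE.
Qed.

(** The frame vectors are rescaled by x and y, and r is absorbed by the free determinant d. *)
Lemma bstd_rescale r x y a b c a' b' c' : r != 0 -> x != 0 -> y != 0 ->
  a' = r * a * x ^+ 2 -> b' = r * b * y ^+ 2 -> c' = r * c * (x * y) ->
  GLorbit (bstd a' b' c') `<=` GLorbit (bstd a b c).
Proof.
move=> r0 x0 y0 -> -> -> C; rewrite !GLorbit_bstd => -[d [u [w [d0 uw0 ->]]]] /=.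
exists (d / r), (x *: u), (y *: w).
split; first by rewrite mulf_neq0 ?invr_eq0.
  by rewrite crossZl crossZr !scaler_eq0 !negb_or x0 y0 uw0.
rewrite frame_br_Zr frame_br_Zl invf_div mulrC.
apply/matrixP => i j; rewrite [LHS]mxE [RHS]mxE !frame_brE; ring.
Qed.

(** The frame stays fixed while the coefficients follow a path of degree at most two in t; its
    points for t > 0 lie in B and it ends at C when t tends to 0 from the right. *)
Lemma closure_GLorbit_bstd (B : set 'M[R]_3) a b c a1 b1 c1 a2 b2 c2 :
  (forall t, 0 < t -> GLorbit (bstd (a + t * a1 + t ^+ 2 * a2) (b + t * b1 + t ^+ 2 * b2)
     (c + t * c1 + t ^+ 2 * c2)) `<=` B) ->
  GLorbit (bstd a b c) `<=` closure B.
Proof.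
move=> tB C; rewrite GLorbit_bstd => -[d [u [w [d0 uw0 CE]]]].
pose f t := d^-1 *: frame_br (a + t * a1 + t ^+ 2 * a2) (b + t * b1 + t ^+ 2 * b2)
     (c + t * c1 + t ^+ 2 * c2) u w.
have fB t : 0 < t -> B (f t).
  by move=> t0; apply: (tB _ t0); rewrite GLorbit_bstd; exists d, u, w.
have f0 : f 0 = C by rewrite /f CE expr0n /= !mul0r !addr0.
have fc : {for 0, continuous f}.
  apply: cvg_mx_entries => i j.
  rewrite (_ : (fun t => _) = horner (
    (f 0 i j)%:P + 'X * (d^-1 * frame_br a1 b1 c1 u w i j)%:P
     + 'X^2 * (d^-1 * frame_br a2 b2 c2 u w i j)%:P)).
    exact: continuous_horner.
  apply/funext => t; rewrite !hornerE /= f0 CE /f ![(_ *: frame_br _ _ _ _ _) _ _]mxE !frame_brE; ring.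
move=> V; rewrite -f0 => /fc fV.
have [t [t0 Vt]] : exists t, 0 < t /\ V (f t).
  apply: (@filter_ex _ ((0 : R)^'+)); near=> t; split=> //.
  by near: t; apply: cvg_at_right_filter fV.
by exists (f t); split=> //; exact: fB.
Unshelve. all: by end_near. Qed.
End ClosureTools.

(** * Closures type by type *)

Section OrbitClosures.
Context {R : realType}.
Implicit Types (A C M S g : 'M[R]_3) (u v w n : 'cV[R]_3) (a b c d h eps : R).

Lemma bIE : bI = bstd 0 0 0 :> 'M[R]_3.
Proof.
by apply/matrixP => i j; rewrite !mxE; elim/ord3P: i; elim/ord3P: j => /=; ring.
Qed.

Lemma closure_GLorbit_I (B : set 'M[R]_3) a b c :
  GLorbit (bstd a b c) `<=` B -> GLorbit bI `<=` closure B.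
Proof.
move=> sB; rewrite bIE.
apply: (@closure_GLorbit_bstd _ _ _ _ _ a b c 0 0 0) => t t0.
apply: subset_trans sB.
by apply: (@bstd_rescale _ t 1 1); rewrite ?oner_neq0 ?lt0r_neq0 //; ring.
Qed.

(** Shrinking the second frame vector by t gives (1, t^2 eps, t h), which tends to (1, 0, 0). *)
Lemma closure_GLorbit_II (B : set 'M[R]_3) eps h :
  GLorbit (bstd 1 eps h) `<=` B -> GLorbit bII `<=` closure B.
Proof.
move=> sB; rewrite bIIE.
apply: (@closure_GLorbit_bstd _ _ _ _ _ 0 0 h 0 eps 0) => t t0.
apply: subset_trans sB.
by apply: (@bstd_rescale _ 1 1 t); rewrite ?oner_neq0 ?lt0r_neq0 //; ring.
Qed.

(** Here h = s / t tends to infinity, s being its sign: -1 for VI_h and 1 for VII_h. Scaling the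
    second frame vector by s t gives (1, t^2 eps, 1). *)
Lemma closure_GLorbit_IV (B : set 'M[R]_3) eps s : s ^+ 2 = 1 ->
  (forall t, 0 < t -> GLorbit (bstd 1 eps (s * t)) `<=` B) ->
  GLorbit bIV `<=` closure B.
Proof.
move=> s2 sB; rewrite bIVE.
have s0 : s != 0 by apply: contra_eq_neq s2 => ->; rewrite expr0n /= eq_sym oner_neq0.
apply: (@closure_GLorbit_bstd _ _ _ _ _ 0 0 0 0 eps 0) => t t0.
have t0' := lt0r_neq0 t0.
have tV : 0 < t^-1 by rewrite invr_gt0.
apply: subset_trans (sB _ tV).
apply: (@bstd_rescale _ 1 1 (s * t)); rewrite ?oner_neq0 ?mulf_neq0 //.
- by ring.
- by rewrite exprMn s2; ring.
- by transitivity (s ^+ 2); [rewrite s2; ring | field; exact: t0'].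
Qed.

(** Again h = s / t tends to infinity, but now the overall scalar t shrinks the symmetric part: (t,
    t eps, 1). The case eps = 0 serves the closure of type IV. *)
Lemma closure_GLorbit_V (B : set 'M[R]_3) eps s : s ^+ 2 = 1 ->
  (forall t, 0 < t -> GLorbit (bstd 1 eps (s * t)) `<=` B) ->
  GLorbit bV `<=` closure B.
Proof.
move=> s2 sB; rewrite bVE.
have s0 : s != 0 by apply: contra_eq_neq s2 => ->; rewrite expr0n /= eq_sym oner_neq0.
apply: (@closure_GLorbit_bstd _ _ _ _ _ 1 eps 0 0 0 0) => t t0.
have t0' := lt0r_neq0 t0.
have tV : 0 < t^-1 by rewrite invr_gt0.
apply: subset_trans (sB _ tV).
apply: (@bstd_rescale _ t 1 s); rewrite ?oner_neq0 //.
- by ring.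
- by rewrite s2; ring.
- by transitivity (s ^+ 2); [rewrite s2; ring | field; exact: t0'].
Qed.

Lemma closure_GLorbit_rank2_unimod (B : set 'M[R]_3) eps s :
  (forall t, 0 < t -> GLorbit (bstd 1 eps (s * t)) `<=` B) ->
  GLorbit (bstd 1 eps 0) `<=` closure B.
Proof.
move=> sB; apply: (@closure_GLorbit_bstd _ _ _ _ _ 0 0 s 0 0 0) => t t0.
by apply: subset_trans (sB _ t0); rewrite !mulr0 !addr0 add0r (mulrC t).
Qed.

Lemma closure_bV : closure (GLorbit bV) = GLorbit bV `|` GLorbit (bI : 'M[R]_3).
Proof.
apply/seteqP; split=> [C BC|C [|]].
- have S0 : unimod C = 0.
    apply/matrixP => i j; rewrite [RHS]mxE.
    apply: (closure_polyfun_eq (polyfun_unimod i j) (polyfun_cst _ _ 0) _ BC).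
    by rewrite GLorbit_V => D [-> _]; rewrite mxE.
  have [nu0|nu0] := eqVneq (nu_of C) 0; last by left; rewrite GLorbit_V.
  by right; rewrite GLorbit_I /= [C]unimodK S0 nu0 jmap0 addr0.
- exact: subset_closure.
- by apply: (@closure_GLorbit_I _ 0 0 1); rewrite bVE.
Qed.

Lemma closure_bV_W2 : closure (GLorbit bV) = W2 :> set 'M[R]_3.
Proof.
rewrite closure_bV W2E GLorbit_I GLorbit_V; apply/seteqP; split=> [C [[]//|->]|C /= S0].
  by rewrite /= unimodE trmx0 addr0 scaler0.
have [nu0|nu0] := eqVneq (nu_of C) 0; last by left.
by right; rewrite [C]unimodK S0 nu0 jmap0 addr0.
Qed.

Lemma jacobi_cof0 C : jacobi C -> cof3 (unimod C) = 0 ->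
  (GLorbit bIV `|` GLorbit bII `|` GLorbit bV `|` GLorbit bI) C.
Proof.
move=> jC cof0; have [S0|S0] := eqVneq (unimod C) 0.
  have [nu0|nu0] := eqVneq (nu_of C) 0; last by left; right; rewrite GLorbit_V.
  by right; rewrite GLorbit_I /= [C]unimodK S0 nu0 jmap0 addr0.
have [nu0|nu0] := eqVneq (nu_of C) 0; left; left; [right|left].
  by rewrite GLorbit_II.
by rewrite GLorbit_IV.
Qed.

Lemma GLorbit_jacobi a b c C : GLorbit (bstd a b c) C -> jacobi C.
Proof. by case/GLorbit_invariants. Qed.

Lemma closure_bIV : closure (GLorbit bIV) =
  GLorbit bIV `|` GLorbit bII `|` GLorbit bV `|` GLorbit (bI : 'M[R]_3).
Proof.
have e2 : (1 : R) ^+ 2 = 1 by rewrite expr1n.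
apply/seteqP; split=> [C BC|C [[[|]|]|]].
- apply: jacobi_cof0.
    by apply: closure_jacobi BC => D; rewrite bIVE; exact: GLorbit_jacobi.
  apply/matrixP => i j; rewrite [RHS]mxE.
  apply: (closure_polyfun_eq (polyfun_cof3_unimod i j) (polyfun_cst _ _ 0) _ BC).
  by rewrite GLorbit_IV => D [_ -> _ _]; rewrite mxE.
- exact: subset_closure.
- by apply: (@closure_GLorbit_II _ 0 1); rewrite bIVE.
- apply: (@closure_GLorbit_V _ 0 1) => // t t0; rewrite bIVE.
  by apply: (@bstd_rescale _ 1 1 t); rewrite ?oner_neq0 ?lt0r_neq0 //; ring.
- by apply: (@closure_GLorbit_I _ 1 0 1); rewrite bIVE.
Qed.

(** The relation nu^T nu = eps h^2 cof S passes to limits. A limit with nu <> 0 is still in the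
    orbit; nu = 0 forces cof S = 0, leaving types II and I. *)
Lemma closure_rank2 eps h : eps ^+ 2 = 1 -> h != 0 ->
  closure (GLorbit (bstd 1 eps h)) =
  GLorbit (bstd 1 eps h) `|` GLorbit bII `|` GLorbit bI.
Proof.
move=> e2 h0; have e0 : eps != 0.
  by apply: contra_eq_neq e2 => ->; rewrite expr0n /= eq_sym oner_neq0.
apply/seteqP; split=> [C BC|C [[|]|]].
- have jC : jacobi C by apply: closure_jacobi BC => D; exact: GLorbit_jacobi.
  have nuE : (nu_of C)^T *m nu_of C = (eps * h ^+ 2) *: cof3 (unimod C).
    apply/matrixP => i j; rewrite [LHS]mxE big_ord1 [X in X * _]mxE [RHS]mxE.
    apply: (closure_polyfun_eq (f := fun C => nu_of C 0 i * nu_of C 0 j)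
      (g := fun C => eps * h ^+ 2 * cof3 (unimod C) i j) _ _ _ BC).
    + exact: polyfun_tr_nu_of.
    + by polyt; exact: polyfun_cof3_unimod.
    + rewrite GLorbit_rank2 // => D [_ _ /matrixP/(_ i j)].
      by rewrite [LHS]mxE big_ord1 [X in X * _]mxE [RHS]mxE.
  have [nu0|nu0] := eqVneq (nu_of C) 0; last by left; left; rewrite GLorbit_rank2.
  have cof0 : cof3 (unimod C) = 0.
    have eh0 : eps * h ^+ 2 != 0 by rewrite mulf_neq0 ?expf_neq0.
    by apply: (scalerI eh0); rewrite -nuE nu0 mulmx0 scaler0.
  have [S0|S0] := eqVneq (unimod C) 0; [right|left; right].
    by rewrite GLorbit_I /= [C]unimodK S0 nu0 jmap0 addr0.
  by rewrite GLorbit_II.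
- exact: subset_closure.
- exact: (@closure_GLorbit_II _ eps h).
- exact: (@closure_GLorbit_I _ 1 eps h).
Qed.

(** Types IV and V have nu <> 0 but cof S = 0, against the relation that persists in the closure. *)
Lemma closure_rank2_disj eps h : eps ^+ 2 = 1 -> h != 0 ->
  closure (GLorbit (bstd 1 eps h)) `&` GLorbit bIV = set0 /\
  closure (GLorbit (bstd 1 eps h)) `&` GLorbit bV = set0.
Proof.
move=> e2 h0; have e0 : eps != 0.
  by apply: contra_eq_neq e2 => ->; rewrite expr0n /= eq_sym oner_neq0.
have nz C : closure (GLorbit (bstd 1 eps h)) C -> nu_of C != 0 ->
    cof3 (unimod C) = 0 -> False.
  rewrite closure_rank2 // => -[[|]|].
  - rewrite GLorbit_rank2 // => -[_ _ nuE] nu0 cof0.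
    by move: (cov_sq_neq0 nu0); rewrite nuE cof0 scaler0 eqxx.
  - by rewrite GLorbit_II => -[-> _ _]; rewrite eqxx.
  - rewrite GLorbit_I => ->; have -> : nu_of (0 : 'M[R]_3) = 0.
      by rewrite -jmap0 nu_of_jmap.
    by rewrite eqxx.
split; apply/seteqP; split=> // C [clC].
  by rewrite GLorbit_IV => -[_ cof0 _ nu0]; exact: (nz C).
rewrite GLorbit_V => -[S0 nu0]; apply: (nz C) => //.
by rewrite S0; apply/matrixP => i j; rewrite !mxE; ring.
Qed.

Lemma closure_VII_all : let VII : set 'M[R]_3 :=
  \bigcup_(h in [set h : R | 0 < h]) GLorbit (bstd 1 1 h) in
  closure VII = VII `|` GLorbit bII `|` GLorbit bI
    `|` GLorbit bIV `|` GLorbit bV `|` GLorbit (bstd 1 1 0).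
Proof.
move=> VII; have e2 : (1 : R) ^+ 2 = 1 by rewrite expr1n.
have VIIE C : VII C -> jacobi C /\ exists2 h, 0 < h &
    (nu_of C)^T *m nu_of C = h ^+ 2 *: cof3 (unimod C).
  move=> [h /= h0]; rewrite GLorbit_rank2 // ?lt0r_neq0 // mul1r => -[jC _ nuE].
  by split=> //; exists h.
have subVII h : 0 < h -> GLorbit (bstd 1 1 h) `<=` VII by move=> h0 C BC; exists h.
have subVII1 h : 0 < h -> GLorbit (bstd 1 1 (1 * h)) `<=` VII.
  by rewrite mul1r; exact: subVII.
apply/seteqP; split=> [C BC|C [[[[[|]|]|]|]|]]; last 1 first.
- exact: (@closure_GLorbit_rank2_unimod _ 1 1).
- have jC : jacobi C by apply: closure_jacobi BC => D /VIIE[].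
  have T := tr_cof3 (tr_unimod C); set K := cof3 _ in T.
  (* The parameter h varies over the union, so only relations free of it survive in the limit:
     nonnegative diagonal and vanishing minors of K, and proportionality of its columns to nu. *)
  have cofE D : VII D -> exists2 k, 0 < k & forall i j,
      cof3 (unimod D) i j = k * (nu_of D 0 i * nu_of D 0 j).
    move=> /VIIE[_ [h h0 nuE]]; exists (h ^- 2); first by rewrite invr_gt0 exprn_gt0.
    move=> i j; move/matrixP/(_ i j): nuE; rewrite mxE big_ord1 mxE => ->.
    by rewrite [X in _ = _ * X]mxE mulKf // expf_neq0 // lt0r_neq0.
  have K0 i : 0 <= K i i.
    apply: (closure_polyfun_ge0 (polyfun_cof3_unimod i i) _ BC) => D /cofE[k k0 ->].
    by rewrite mulr_ge0 ?(ltW k0) // -expr2 sqr_ge0.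
  have Kmin i j k l : K i j * K k l = K i l * K k j.
    apply: (closure_polyfun_eq (f := fun C => cof3 (unimod C) i j * cof3 (unimod C) k l)
      (g := fun C => cof3 (unimod C) i l * cof3 (unimod C) k j) _ _ _ BC).
    + by polyt; exact: polyfun_cof3_unimod.
    + by polyt; exact: polyfun_cof3_unimod.
    + by move=> D /cofE[t _ tE]; rewrite !tE; ring.
  have Knu i j k : nu_of C 0 i * K j k = nu_of C 0 j * K i k.
    apply: (closure_polyfun_eq (f := fun C => nu_of C 0 i * cof3 (unimod C) j k)
      (g := fun C => nu_of C 0 j * cof3 (unimod C) i k) _ _ _ BC).
    + by polyt; [exact: polyfun_nu_of | exact: polyfun_cof3_unimod].
    + by polyt; [exact: polyfun_nu_of | exact: polyfun_cof3_unimod].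
    + by move=> D /cofE[t _ tE]; rewrite !tE; ring.
  have [cof0|cof0] := eqVneq K 0.
    have [[[BC'|BC']|BC']|BC'] := jacobi_cof0 jC cof0.
    + by left; left; right.
    + by do 4!left; right.
    + by left; right.
    + by do 3!left; right.
  have [n n0 KE] := psd_rank1 T K0 Kmin cof0.
  have [nu0|nu0] := eqVneq (nu_of C) 0.
    right; rewrite GLorbit_rank2_unimod //=; split=> //.
    by exists n; rewrite ?scale1r.
  have [i ni] : exists i, n i 0 != 0.
    apply: contrapT => /forallNP h; move/eqP: n0; apply; apply/colP => i.
    by move/negP/negPn/eqP: (h i) => ->; rewrite mxE.
  have KEe k l : K k l = n k 0 * n l 0 by rewrite KE !(mxE, big_ord1).
  (* Now K = n n^T and nu is proportional to n; the ratio recovers h up to sign. *)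
  pose h := nu_of C 0 i / n i 0.
  have nuE j : nu_of C 0 j = h * n j 0.
    have := Knu i j i; rewrite !KEe mulrA [RHS]mulrA => /(mulIf ni) e.
    by rewrite /h mulrAC e mulfK.
  have h0 : h != 0.
    apply: contraNneq nu0 => h0; apply/eqP/rowP => j.
    by rewrite nuE h0 mul0r mxE.
  do 5! left; exists `|h|; rewrite /= ?normr_gt0 // GLorbit_rank2 ?normr_eq0 //.
  split=> //; rewrite -/K KE; apply/matrixP => k l.
  rewrite [LHS]mxE big_ord1 [X in X * _]mxE !nuE !(mxE, big_ord1).
  by rewrite -normrX ger0_norm ?sqr_ge0 //; ring.
- exact: subset_closure.
- exact: (closure_GLorbit_II (subVII 1 ltr01)).
- exact: (closure_GLorbit_I (subVII 1 ltr01)).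
- exact: (@closure_GLorbit_IV _ 1 1).
- exact: (@closure_GLorbit_V _ 1 1).
Qed.

End OrbitClosures.

(** * Stabilizers *)

Lemma ord2P (P : 'I_2 -> Prop) : P 0 -> P 1 -> forall i, P i.
Proof.
move=> P0 P1 [[|[|//]] lt_i2].
- by rewrite (_ : Ordinal _ = 0) //; exact: val_inj.
- by rewrite (_ : Ordinal _ = 1) //; exact: val_inj.
Qed.

Lemma sum2E (V : nmodType) (F : 'I_2 -> V) : \sum_i F i = F 0 + F 1.
Proof.
rewrite !big_ord_recl big_ord0 addr0.
by congr (F _ + F _); exact: val_inj.
Qed.

Section Stabilizers.
Context {R : realType}.
Implicit Types (C M S g : 'M[R]_3) (K : set 'M[R]_2) (a b c d h eps : R).

Lemma det2E (A : 'M[R]_2) : \det A = A 0 0 * A 1 1 - A 0 1 * A 1 0.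
Proof.
have [F ->] : exists F : nat -> nat -> R, A = \matrix_(i, j) F i j.
  exists (fun i j => A (inord i) (inord j)).
  by apply/matrixP => i j; rewrite mxE !inord_val.
rewrite (expand_det_row _ 0) sum2E /cofactor !det_mx11 !mxE /=.
rewrite /bump /=; ring.
Qed.

Lemma det_affmx (x : 'M[R]_2 * 'cV[R]_2) : \det (affmx x) = \det x.1.
Proof. by rewrite /affmx (@det_ublock _ 2 1) det1 mulr1. Qed.

Lemma GL_affmx (x : 'M[R]_2 * 'cV[R]_2) : GL (affmx x) <-> GL x.1.
Proof. by rewrite /GL /= !unitmxE det_affmx. Qed.

Definition affpart g : 'M[R]_2 * 'cV[R]_2 :=
  (ulsubmx (g : 'M[R]_(2 + 1)), ursubmx (g : 'M[R]_(2 + 1))).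

Lemma affmxK : cancel affmx affpart.
Proof. by case=> A c; rewrite /affpart /affmx block_mxKul block_mxKur. Qed.

Lemma affmxM (x y : 'M[R]_2 * 'cV[R]_2) : affmx x *m affmx y = affmx (sdprod_mul x y).
Proof.
rewrite /affmx; have := @mulmx_block R 2 1 2 1 2 1 x.1 x.2 0 1%:M y.1 y.2 0 1%:M.
by rewrite !mulmx0 !mul0mx !mulmx1 !addr0 add0r [_ + x.2]addrC.
Qed.

Lemma affpartK g : row 2 g = delta_mx 0 2 -> affmx (affpart g) = g.
Proof.
move=> /rowP g2; have E i : g 2 i = (i == 2)%:R by have := g2 i; rewrite !mxE eqxx.
have dl : dlsubmx (g : 'M[R]_(2 + 1)) = 0.
  apply/matrixP => i j; rewrite !mxE !ord1 (_ : rshift 2 _ = 2); last exact: val_inj.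
  rewrite E; case: eqP => // /(congr1 val) /= j2.
  by have := ltn_ord j; rewrite j2.
have dr : drsubmx (g : 'M[R]_(2 + 1)) = 1%:M.
  apply/matrixP => i j; rewrite !mxE !ord1 (_ : rshift 2 _ = 2) ?E ?eqxx //; exact: val_inj.
by rewrite -[RHS](@submxK _ 2 1 2 1 g) dl dr.
Qed.

Definition diag2 a b : 'M[R]_2 :=
  \matrix_(i, j) (nth [::] [:: [:: a; 0]; [:: 0; b]] i)`_j.

(** Fixing the symmetric block under the twisted action (det g)^-1 g C g^T. The form D may be
    degenerate, so that types IV and V are covered as well. *)
Definition confdet (D : 'M[R]_2) : set 'M[R]_2 :=
  [set g1 | GL g1 /\ g1 *m D *m g1^T = \det g1 *: D].

Lemma COdetE (eta : 'M[R]_2) : COdet eta = confdet eta.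
Proof.
apply/seteqP; split=> [g1 [[g1U _] e]|g1 [g1U e]] //; split=> //; split=> //.
by exists (\det g1) => //; rewrite -unitfE -unitmxE.
Qed.

(** The skew block is a multiple of the standard symplectic form J, and A J A^T = (det A) J cancels
    the determinant. The translation column meets only the zero third row and column of
    [bstd a b c]. *)
Lemma act_affmx (x : 'M[R]_2 * 'cV[R]_2) a b c : GL x.1 ->
  act (affmx x) (bstd a b c) =
  block_mx ((\det x.1)^-1 *: (x.1 *m diag2 a b *m x.1^T)) 0 0 0 + bstd 0 0 c
    :> 'M[R]_(2 + 1).
Proof.
move=> xU; rewrite actE; last exact/GL_affmx.
have dx : \det x.1 != 0 by rewrite -unitfE -unitmxE.
pose J : 'M[R]_2 := \matrix_(i, j) (nth [::] [:: [:: 0; 1]; [:: -1; 0]] i)`_j.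
have bE p q r : bstd p q r = block_mx (diag2 p q + r *: J) 0 0 0 :> 'M[R]_(2 + 1).
  rewrite -[LHS](@submxK _ 2 1 2 1); congr block_mx; apply/matrixP => i j; rewrite !mxE //=.
  - by elim/ord2P: i; elim/ord2P: j => /=; ring.
  - by elim/ord2P: i; rewrite (ord1 j).
  - by elim/ord2P: j; rewrite (ord1 i).
  - by rewrite (ord1 i) (ord1 j).
have JE : x.1 *m J *m x.1^T = \det x.1 *: J.
  rewrite det2E; apply/matrixP => i j; rewrite !(mxE, sum2E).
  by elim/ord2P: i; elim/ord2P: j => /=; ring.
have d0 : diag2 0 0 = 0.
  by apply/matrixP => i j; rewrite !mxE; elim/ord2P: i; elim/ord2P: j.
have key (N : 'M[R]_2) : affmx x *m (block_mx N 0 0 0 : 'M[R]_(2 + 1)) *m (affmx x)^T =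
    (block_mx (x.1 *m N *m x.1^T) 0 0 0 : 'M[R]_(2 + 1)).
  rewrite /affmx (@tr_block_mx _ 2 1 2 1) (@mulmx_block _ 2 1 2 1 2 1).
  rewrite (@mulmx_block _ 2 1 2 1 2 1).
  by rewrite !(mulmx0, mul0mx, addr0, trmx0).
rewrite !bE d0 add0r key det_affmx.
rewrite (@scale_block_mx _ 2 1 2 1) (@add_block_mx _ 2 1 2 1) !(scaler0, addr0).
congr (block_mx _ _ _ _); rewrite mulmxDr mulmxDl scalerDr; congr (_ + _).
by rewrite -scalemxAr -scalemxAl JE scalerA [_ * c]mulrC -scalerA scalerK.
Qed.

Lemma nu_of_bstd a b c : nu_of (bstd a b c) = c *: delta_mx 0 2.
Proof.
apply/rowP => j; rewrite nu_ofE !mxE eqxx /=.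
by elim/ord3P: j; rewrite ?ord3DE ?ord3_eqE ?eqxx /=; field.
Qed.

(** Since c <> 0, the invariant covector c e3^* forces the last row of g to be (0, 0, 1); what
    remains is the condition on the symmetric block. *)
Lemma Stab_bstd a b c : c != 0 ->
  Stab (bstd a b c) = affmx @` sdprod_set (confdet (diag2 a b)).
Proof.
move=> c0; have affS (x : 'M[R]_2 * 'cV[R]_2) : GL x.1 ->
    act (affmx x) (bstd a b c) = bstd a b c <-> confdet (diag2 a b) x.1.
  move=> xU; have dx : \det x.1 != 0 by rewrite -unitfE -unitmxE.
  have aE : act (affmx (1%:M, 0)) (bstd a b c) = bstd a b c.
    rewrite (_ : affmx _ = 1%:M) ?act1 //.
    by rewrite /affmx /= -(scalar_mx_block 2 1).
  rewrite -{2}aE !act_affmx //; last by rewrite /GL /= unitmx1.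
  rewrite /= det1 invr1 scale1r trmx1 mul1mx mulmx1; split.
    move=> /addIr /(congr1 (@ulsubmx _ 2 1 2 1)); rewrite !(@block_mxKul _ 2 1 2 1).
    by move=> e; split=> //; rewrite -[diag2 a b in RHS]e scalerA mulfV // scale1r.
  by move=> [_ ->]; rewrite scalerK.
apply/seteqP; split=> [g [gU gS]|_ [x [xK _] <-]]; last first.
  have xU : GL x.1 by case: xK.
  by split; [exact/GL_affmx | exact/affS].
have gE : affmx (affpart g) = g.
  apply: affpartK; apply: (scalerI c0); rewrite -(nu_of_bstd a b) -[RHS](nu_of_act _ gU) gS.
  by rewrite nu_of_bstd -scalemxAl -rowE.
exists (affpart g) => //; split=> //.
by move: gU gS; rewrite -{1 2}gE => /GL_affmx gU /affS; apply.
Qed.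

End Stabilizers.

Section StabilizerCoordinates.
Context {R : realType}.
Implicit Types (C M S g : 'M[R]_3) (K : set 'M[R]_2) (a b c d h eps : R).

Lemma confdet_diag2 (A : 'M[R]_2) a b (d := A 0 0 * A 1 1 - A 0 1 * A 1 0) :
  confdet (diag2 a b) A <->
  [/\ d != 0, A 0 0 ^+ 2 * a + A 0 1 ^+ 2 * b = d * a,
      A 0 0 * A 1 0 * a + A 0 1 * A 1 1 * b = 0
    & A 1 0 ^+ 2 * a + A 1 1 ^+ 2 * b = d * b].
Proof.
rewrite /confdet /GL /= unitmxE unitfE det2E -/d; split=> [[d0 /matrixP e]|[d0 e1 e2 e3]].
  have := (e 0 0, e 0 1, e 1 1); rewrite !(mxE, sum2E) /= !(mulr0, addr0, add0r).
  by move=> [[e1 e2] e3]; split=> //; rewrite -?e1 -?e2 -?e3; ring.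
split=> //; apply/matrixP; apply: ord2P; apply: ord2P;
  rewrite !(mxE, sum2E) /=.
- by rewrite -e1; ring.
- by rewrite [RHS]mulr0 -[RHS]e2; ring.
- by rewrite [RHS]mulr0 -[RHS]e2; ring.
- by rewrite -e3; ring.
Qed.

Lemma affmx_imageP K g : (affmx @` sdprod_set K) g <->
  row 2 g = delta_mx 0 2 /\ K (affpart g).1.
Proof.
split=> [[x [Kx _] <-]|[g2 Kg]]; last first.
  by exists (affpart g); [split | exact: affpartK].
rewrite affmxK; split=> //; apply/rowP => j; rewrite /affmx [LHS]mxE [RHS]mxE eqxx /=.
rewrite (_ : 2 = rshift 2 (0 : 'I_1)); last exact: val_inj.
case: (@split_ordP 2 1 j) => k ->.
  rewrite (@block_mxEdl _ 2 1 2 1) mxE; case: eqP => // /(congr1 val) /= k2.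
  by have := ltn_ord k; rewrite k2.
by rewrite (@block_mxEdr _ 2 1 2 1) mxE !ord1.
Qed.

Lemma Stab_bstd_coord a b c g (d := g 0 0 * g 1 1 - g 0 1 * g 1 0) : c != 0 ->
  Stab (bstd a b c) g <->
  [/\ g 2 0 = 0, g 2 1 = 0 & g 2 2 = 1] /\
  [/\ d != 0, g 0 0 ^+ 2 * a + g 0 1 ^+ 2 * b = d * a,
      g 0 0 * g 1 0 * a + g 0 1 * g 1 1 * b = 0
    & g 1 0 ^+ 2 * a + g 1 1 ^+ 2 * b = d * b].
Proof.
move=> c0; rewrite Stab_bstd // affmx_imageP confdet_diag2.
have EA (i j : 'I_2) (i' j' : 'I_3) : i = i' :> nat -> j = j' :> nat ->
    (affpart g).1 i j = g i' j'.
  by move=> ii jj; rewrite !mxE; congr (g _ _); exact: val_inj.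
rewrite (EA 0 0 0 0) // (EA 0 1 0 1) // (EA 1 0 1 0) // (EA 1 1 1 1) //.
split=> -[g2 Kg]; split=> //.
  by move/rowP: g2 => g2; have := (g2 0, g2 1, g2 2); rewrite !mxE /= => -[[-> ->] ->].
by case: g2 => g20 g21 g22; apply/rowP; apply: ord3P; rewrite !mxE.
Qed.

Lemma Stab_bV_coord g : Stab bV g <->
  [/\ g 2 0 = 0, g 2 1 = 0, g 2 2 = 1 & g 0 0 * g 1 1 - g 0 1 * g 1 0 != 0].
Proof.
rewrite bVE Stab_bstd_coord ?oner_neq0 //; split=> [[[? ? ?] []]|[? ? ? ?]] //.
by split=> //; split=> //; ring.
Qed.

Lemma Stab_bIV_coord g : Stab bIV g <->
  [/\ g 2 0 = 0, g 2 1 = 0 & g 2 2 = 1] /\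
  [/\ g 1 0 = 0, g 1 1 = g 0 0 & g 0 0 != 0].
Proof.
rewrite bIVE Stab_bstd_coord ?oner_neq0 //; split=> -[g2 []].
  rewrite !mulr1 !mulr0 !addr0 => d0 e1 _ /eqP; rewrite sqrf_eq0 => /eqP g10.
  have g00 : g 0 0 != 0.
    by apply: contraNneq d0 => g00; rewrite g00 g10 mul0r mulr0 subrr.
  by split=> //; split=> //; apply: (mulfI g00); rewrite -expr2 e1 g10 mulr0 subr0.
move=> -> -> g00; split=> //; split; rewrite ?mulr0 ?subr0 ?mulf_neq0 //; ring.
Qed.

(** The upper left blocks are the multiplications by invertible complex numbers for eps = 1 and by
    invertible split-complex numbers for eps = -1. *)
Lemma Stab_rank2_coord eps h g : eps ^+ 2 = 1 -> h != 0 -> Stab (bstd 1 eps h) g <->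
  [/\ g 2 0 = 0, g 2 1 = 0 & g 2 2 = 1] /\
  [/\ g 1 0 = - eps * g 0 1, g 1 1 = g 0 0 & g 0 0 ^+ 2 + eps * g 0 1 ^+ 2 != 0].
Proof.
move=> eps2 h0; rewrite Stab_bstd_coord //; split=> -[g2 []].
  move: (g 0 0) (g 0 1) (g 1 0) (g 1 1) => p q r s; rewrite !mulr1 => d0 e1 e2 e3.
  have sE : s = p.
    apply: (mulfI d0); rewrite mulrC -[in LHS]e1.
    (* Subtracting q times the vanishing off-diagonal equation leaves p (p s - q r). *)
    transitivity (s * (p ^+ 2 + q ^+ 2 * eps) - q * (p * r + q * s * eps)).
      by rewrite e2; ring.
    by ring.
  have rE : r = - eps * q.
    apply: (mulfI d0); rewrite mulrC -[in LHS]e1.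
    transitivity (r * (p ^+ 2 + q ^+ 2 * eps) - p * (p * r + q * s * eps)).
      by rewrite e2; ring.
    by ring.
  by split=> //; split=> //; move: d0; rewrite sE rE; congr (_ != 0); ring.
move=> -> -> d0; split=> //; split.
- by move: d0; congr (_ != 0); ring.
- by ring.
- by ring.
- by ring.
Qed.

End StabilizerCoordinates.

Ltac polyentry := eapply eq_polyfun;
  [let x := fresh in intro x; rewrite [RHS]mxE /=; reflexivity | polyt].

(** * Charts on the stabilizers *)

Section StabilizerCharts.
Context {R : realType}.
Implicit Types (C M S g : 'M[R]_3) (a b c d h eps : R).

Lemma open_polyfun_neq0 m n (f : 'M[R]_(m, n) -> R) : polyfun f ->
  open [set x | f x != 0].
Proof.
move=> pf; apply: (@open_comp _ _ f [set x | x != 0]); last exact: open_neq.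
by move=> x _; exact: polyfun_continuous.
Qed.

Lemma open_polyfun_gt0 m n (f : 'M[R]_(m, n) -> R) : polyfun f ->
  open [set x | 0 < f x].
Proof.
move=> pf; apply: (@open_comp _ _ f [set x | 0 < x]); last exact: open_gt.
by move=> x _; exact: polyfun_continuous.
Qed.

Definition seqrow k (s : seq R) : 'rV[R]_k := \row_j s`_j.

Lemma global_chart k (S : set 'M[R]_3) (D : set 'rV[R]_k)
  (f : 'rV[R]_k -> 'M[R]_3) (g : 'M[R]_3 -> 'rV[R]_k) : open D ->
  polymap f -> polymap g -> (forall p, D p -> S (f p) /\ g (f p) = p) ->
  (forall y, S y -> D (g y) /\ f (g y) = y) -> forall x, S x -> chart k S x.
Proof.
move=> oD pf pg fg gf x Sx; exists setT, D, f, g; split; first by split=> //; exact: openT.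
split=> [p Dp|p /fg[]|y /gf[]] //; exact: polymap_differentiable.
Qed.

Lemma mx3P (M N : 'M[R]_3) :
  [/\ M 0 0 = N 0 0, M 0 1 = N 0 1 & M 0 2 = N 0 2] ->
  [/\ M 1 0 = N 1 0, M 1 1 = N 1 1 & M 1 2 = N 1 2] ->
  [/\ M 2 0 = N 2 0, M 2 1 = N 2 1 & M 2 2 = N 2 2] -> M = N.
Proof.
by case=> ? ? ? [? ? ?] [? ? ?]; apply/matrixP; apply: ord3P; apply: ord3P.
Qed.

Lemma submanifold_Stab_bV : submanifold 6 (Stab (bV : 'M[R]_3)).
Proof.
apply/chart_submanifold/(@global_chart _ _ [set x | x 0 0 * x 0 1 - x 0 2 * x 0 3 != 0]
  (fun x => mx3 [:: [:: x 0 0; x 0 2; x 0 4]; [:: x 0 3; x 0 1; x 0 5]; [:: 0; 0; 1]])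
  (fun M => seqrow 6 [:: M 0 0; M 1 1; M 0 1; M 1 0; M 0 2; M 1 2])).
- by apply: open_polyfun_neq0; polyt.
- by apply: ord3P; apply: ord3P; polyentry.
- by move=> i [[|[|[|[|[|[|//]]]]]] lj]; polyentry.
- move=> x Dx; rewrite Stab_bV_coord !mxE /=; split=> //.
  apply/rowP => j; rewrite !mxE /=; case: j => [[|[|[|[|[|[|//]]]]]] lj] /=;
   congr (x _ _); exact: val_inj.
- move=> M /Stab_bV_coord [M20 M21 M22 d0]; split; first by rewrite /= !mxE /=.
  by apply: mx3P; rewrite !mxE.
Qed.

Lemma submanifold_Stab_bIV : submanifold 4 (Stab (bIV : 'M[R]_3)).
Proof.
apply/chart_submanifold/(@global_chart _ _ [set x | x 0 0 != 0]
  (fun x => mx3 [:: [:: x 0 0; x 0 1; x 0 2]; [:: 0; x 0 0; x 0 3]; [:: 0; 0; 1]])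
  (fun M => seqrow 4 [:: M 0 0; M 0 1; M 0 2; M 1 2])).
- by apply: open_polyfun_neq0; polyt.
- by apply: ord3P; apply: ord3P; polyentry.
- by move=> i [[|[|[|[|//]]]] lj]; polyentry.
- move=> x Dx; rewrite Stab_bIV_coord !mxE /=; split=> //.
  apply/rowP => j; rewrite !mxE /=; case: j => [[|[|[|[|//]]]] lj] /=;
   congr (x _ _); exact: val_inj.
- move=> M /Stab_bIV_coord [[M20 M21 M22] [M10 M11 M00]]; split; first by rewrite /= !mxE /=.
  by apply: mx3P; rewrite !mxE.
Qed.

(** Type II has nu = 0, so [Stab_bstd] does not apply. Comparing entries of (g e1)(g e1)^T = (det g)
    e1 e1^T, the last two diagonal ones kill the rest of the first column, and the first gives
    g_00^2 = det g. *)
Lemma Stab_bII_coord g : Stab bII g <->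
  [/\ g 1 0 = 0, g 2 0 = 0, g 0 0 = g 1 1 * g 2 2 - g 1 2 * g 2 1
    & g 1 1 * g 2 2 - g 1 2 * g 2 1 != 0].
Proof.
have gE : g *m bstd 1 0 0 *m g^T = \matrix_(i, j) (g i 0 * g j 0).
  by apply/matrixP => i j; rewrite !(mxE, sum3E) /=; ring.
have dE : g 1 0 = 0 -> g 2 0 = 0 -> \det g = g 0 0 * (g 1 1 * g 2 2 - g 1 2 * g 2 1).
  by rewrite det3E => -> ->; ring.
rewrite bIIE; split=> [[gU gS]|[g1 g2 g0 d0]].
  have dg : \det g != 0 by rewrite -unitfE -unitmxE.
  move: gS; rewrite actE // gE => /(congr1 ( *:%R (\det g))).
  rewrite scalerA mulfV // scale1r => /matrixP e.
  have := (e 0 0, e 1 1, e 2 2); rewrite !mxE /= !mulr0 mulr1 -!expr2.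
  move=> [[e0 /eqP]] + /eqP; rewrite !sqrf_eq0 => /eqP g1 /eqP g2.
  have := dg; rewrite dE // mulf_eq0 negb_or => /andP[g0 m0]; split=> //.
  by apply: (mulfI g0); rewrite -dE // -expr2.
have dg : \det g != 0 by rewrite dE // g0 mulf_neq0.
have gU : GL g by rewrite /GL /= unitmxE unitfE.
split=> //; rewrite actE // gE; apply: (scalerI dg); rewrite scalerA mulfV // scale1r.
apply: mx3P; rewrite !mxE /= !(g1, g2, oppr0, mulr0, mul0r) //.
by rewrite dE // g0 mulr1.
Qed.

Lemma submanifold_Stab_bII : submanifold 6 (Stab (bII : 'M[R]_3)).
Proof.
apply/chart_submanifold/(@global_chart _ _ [set x | x 0 0 * x 0 3 - x 0 1 * x 0 2 != 0]
  (fun x => mx3 [:: [:: x 0 0 * x 0 3 - x 0 1 * x 0 2; x 0 4; x 0 5];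
                    [:: 0; x 0 0; x 0 1]; [:: 0; x 0 2; x 0 3]])
  (fun M => seqrow 6 [:: M 1 1; M 1 2; M 2 1; M 2 2; M 0 1; M 0 2])).
- by apply: open_polyfun_neq0; polyt.
- by apply: ord3P; apply: ord3P; polyentry.
- by move=> i [[|[|[|[|[|[|//]]]]]] lj]; polyentry.
- move=> x Dx; rewrite Stab_bII_coord !mxE /=; split=> //.
  apply/rowP => j; rewrite !mxE /=; case: j => [[|[|[|[|[|[|//]]]]]] lj] /=;
   congr (x _ _); exact: val_inj.
- move=> M /Stab_bII_coord [M10 M20 M00 d0]; split; first by rewrite /= !mxE /=.
  by apply: mx3P; rewrite !mxE.
Qed.

Lemma chart_Stab_rank2 eps h g : eps ^+ 2 = 1 -> h != 0 ->
  Stab (bstd 1 eps h) g -> chart 4 (Stab (bstd 1 eps h)) g.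
Proof.
move=> eps2 h0.
apply: (@global_chart _ _ [set x | x 0 0 ^+ 2 + eps * x 0 1 ^+ 2 != 0]
  (fun x => mx3 [:: [:: x 0 0; x 0 1; x 0 2]; [:: - eps * x 0 1; x 0 0; x 0 3]; [:: 0; 0; 1]])
  (fun M => seqrow 4 [:: M 0 0; M 0 1; M 0 2; M 1 2])).
- by apply: open_polyfun_neq0; polyt.
- by apply: ord3P; apply: ord3P; polyentry.
- by move=> i [[|[|[|[|//]]]] lj]; polyentry.
- move=> x Dx; rewrite Stab_rank2_coord // !mxE /=; split=> //.
  apply/rowP => j; rewrite !mxE /=; case: j => [[|[|[|[|//]]]] lj] /=;
   congr (x _ _); exact: val_inj.
- move=> M; rewrite Stab_rank2_coord // => -[[M20 M21 M22] [M10 M11 M00]].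
  split; first by rewrite /= !mxE /=.
  by apply: mx3P; rewrite !mxE.
Qed.

Lemma polymap_mull m n p q (A : 'M[R]_(p, p)) (f : 'M[R]_(m, n) -> 'M[R]_(p, q)) :
  polymap f -> polymap (fun x => A *m f x).
Proof.
move=> pf i j; apply: (eq_polyfun (f := fun x => \sum_k A i k * f x k j)).
  by move=> x; rewrite mxE.
by apply: polyfun_sum => k; polyt; exact: pf.
Qed.

Lemma polymap_act m n g (f : 'M[R]_(m, n) -> 'M[R]_3) : GL g ->
  polymap f -> polymap (act g \o f).
Proof.
move=> gU pf i j; apply: (eq_polyfun (f := fun x => (\det g)^-1 *
  \sum_k (\sum_l g i l * f x l k) * g j k)).
  move=> x; rewrite /= actE // mxE [X in _ = _ * X]mxE; congr (_ * _).
  by apply: eq_bigr => k _; rewrite [X in X * _ = _]/= mxE [X in _ = _ * X]mxE.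
polyt; apply: polyfun_sum => k; polyt; apply: polyfun_sum => l; polyt; exact: pf.
Qed.

Lemma polymap_id m n : polymap (@id 'M[R]_(m, n)).
Proof. by move=> i j; polyt. Qed.

Lemma chart_act k (S : set 'M[R]_3) g C : GL g -> chart k S C -> chart k (act g @` S) (act g C).
Proof.
move=> gU; apply: (chart_image (G := act (invmx g))).
- by move=> p q f; exact: polymap_act.
- by apply: (@polymap_act 3 3 _ id); [exact: GLV | exact: polymap_id].
- by move=> D; exact: actK.
- by move=> D; exact: actVK.
Qed.

End StabilizerCharts.

(** * Stabilizers of types VI_0 and VII_0 *)

Section UnimodularStabilizers.
Context {R : realType}.
Implicit Types (C M S g : 'M[R]_3) (a b c d h eps : R).

Lemma chart_local m n k (H S : set 'M[R]_(m, n)) x (V : set 'M[R]_(m, n)) :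
  H `<=` S -> (forall y, S y -> V y -> H y) -> chart k H x -> open V -> V x ->
  chart k S x.
Proof.
move=> HS SH [U [D [f [g [[oU Ux oD pf] [dg fg gf]]]]]] oV Vx.
exists (U `&` V), (D `&` f @^-1` V), f, g; split; first split=> //.
- exact: openI.
- apply: openI => //; apply: open_comp => // y _; exact: polymap_continuous.
split=> [p [Dp _]|p [Dp Vp]|y Sy [Uy Vy]]; first exact: dg.
  by have [Hp Up gp] := fg p Dp; split=> //; exact: HS.
by have [Dy fy] := gf y (SH y Sy Vy) Uy; split=> //; split=> //=; rewrite fy.
Qed.

(** The half turn about the first axis, which reverses nu on the normal forms and represents the
    second coset in the stabilizer of the unimodular part. *)
Definition refl3 : 'M[R]_3 := mx3 [:: [:: 1; 0; 0]; [:: 0; -1; 0]; [:: 0; 0; -1]].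

Lemma refl3K : refl3 *m refl3 = 1%:M.
Proof. by apply: mx3P; rewrite !(mxE, sum3E) /=; split; ring. Qed.

Lemma GL_refl3 : GL refl3.
Proof. by have [] := mulmx1_unit refl3K. Qed.

Lemma act_refl3 a b c : act refl3 (bstd a b c) = bstd a b (- c).
Proof.
rewrite actE; last exact: GL_refl3.
have -> : \det refl3 = 1 by rewrite det3E !mxE /=; ring.
by rewrite invr1 scale1r; apply: mx3P; rewrite !(mxE, sum3E) /=; split; ring.
Qed.

Lemma cof3_bstd a b c : cof3 (bstd a b c) = (a * b + c ^+ 2) *: delta_mx 2 2.
Proof. by apply: mx3P; rewrite !mxE ?ord3DE /=; split; ring. Qed.

(** If g fixes S, the image under g of the bracket with parameter h has the same S, hence nu^T nu =
    h^2 e3 e3^T and nu = h e3^* or -h e3^*. In the second case composing with [refl3] restores the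
    sign. *)
Lemma Stab_rank2_unimod eps h : eps ^+ 2 = 1 -> h != 0 ->
  Stab (bstd 1 eps 0) = Stab (bstd 1 eps h) `|` mulmx refl3 @` Stab (bstd 1 eps h).
Proof.
move=> e2 h0; apply/seteqP; split=> [g [gU gS]|g [|[k [kU kS] <-]]]; last first.
- split; first by rewrite /GL /= unitmx_mul kU andbT; exact: GL_refl3.
  rewrite actM //; last exact: GL_refl3.
  rewrite -(bstd_unimod 1 eps h) -unimod_act // kS bstd_unimod.
  by rewrite act_refl3 oppr0.
- by move/Stab_unimod; rewrite bstd_unimod.
have oC : GLorbit (bstd 1 eps h) (act g (bstd 1 eps h)) by exists g.
have SE : unimod (act g (bstd 1 eps h)) = bstd 1 eps 0.
  by rewrite unimod_act // bstd_unimod.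
move: oC; rewrite GLorbit_rank2 //= SE => -[_ _].
set nu := nu_of _; rewrite cof3_bstd mul1r expr0n addr0 => /matrixP nuE.
have {}nuE i j : nu 0 i * nu 0 j = (h * h) * (delta_mx 2 2 : 'M[R]_3) i j.
  have := nuE i j; rewrite [LHS]mxE big_ord1 [X in X * _]mxE => ->.
  by rewrite !mxE; move: e2; rewrite expr2 => e2; rewrite -[RHS]mul1r -e2; ring.
have nu0 i : i != 2 -> nu 0 i = 0.
  move=> i2; have /eqP := nuE i i; rewrite [X in _ == _ * X]mxE (negPf i2) /= mulr0.
  by rewrite mulf_eq0 orbb => /eqP.
have actE' s : nu 0 2 = s * h -> act g (bstd 1 eps h) = bstd 1 eps (s * h).
  move=> nu2; rewrite [LHS]unimodK SE -/nu [RHS]unimodK bstd_unimod nu_of_bstd.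
  congr (_ + jmap _); apply/rowP; apply: ord3P;
    rewrite [RHS]mxE [X in _ = _ * X]mxE /= ?mulr0 ?mulr1 //; exact: nu0.
have /eqP := nuE 2 2; rewrite [X in _ == _ * X]mxE /= mulr1 -!expr2 eqf_sqr => /orP[|] /eqP nu2.
  by left; split=> //; rewrite (actE' 1) ?mul1r.
right; exists (refl3 *m g); last by rewrite mulmxA refl3K mul1mx.
split; first by rewrite /GL /= unitmx_mul gU andbT; exact: GL_refl3.
rewrite actM //; last exact: GL_refl3.
by rewrite (actE' (-1)) ?mulN1r // act_refl3 opprK.
Qed.

(** The two cosets are separated by the sign of the last diagonal entry, which is 1 on H and -1 on
    the other. So H is open in S, its charts serve S, and [refl3] carries them to the other
    coset. *)
Lemma submanifold_Stab_rank2_unimod eps : eps ^+ 2 = 1 ->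
  submanifold 4 (Stab (bstd 1 eps 0)).
Proof.
move=> e2; pose H := Stab (bstd 1 eps 1); pose S := Stab (bstd 1 eps 0).
have SE : S = H `|` mulmx refl3 @` H by apply: Stab_rank2_unimod; rewrite ?oner_neq0.
have H22 g : H g -> g 2 2 = 1 by rewrite /H Stab_rank2_coord ?oner_neq0 // => -[[]].
have r22 g : (refl3 *m g) 2 2 = - g 2 2 by rewrite !(mxE, sum3E) /=; ring.
have SH g : S g -> 0 < g 2 2 -> H g.
  rewrite SE => -[//|[k /H22 k22 <-]]; rewrite r22 k22 oppr_gt0.
  by rewrite ltNge ler01.
have HS : H `<=` S by rewrite SE => g; left.
have chH g : H g -> chart 4 S g.
  move=> Hg; apply: (@chart_local _ _ _ H S g [set M : 'M[R]_3 | 0 < M 2 2]) => //.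
  - exact: (chart_Stab_rank2 e2 (oner_neq0 R)).
  - by apply: open_polyfun_gt0; polyt.
  - by rewrite /= H22 ?ltr01.
apply: (@chart_submanifold _ _ _ _ S) => g Sg.
have [Hg|[k Hk <-]] : (H `|` mulmx refl3 @` H) g by rewrite -SE.
  exact: chH.
have rS : mulmx refl3 @` S = S.
  apply/seteqP; split=> [_ [x Sx <-]|x Sx]; last first.
    exists (refl3 *m x); last by rewrite mulmxA refl3K mul1mx.
    move: Sx; rewrite SE => -[Hx|[y Hy <-]]; first by right; exists x.
    by left; rewrite mulmxA refl3K mul1mx.
  move: Sx; rewrite SE => -[Hx|[y Hy <-]]; first by right; exists x.
  by left; rewrite mulmxA refl3K mul1mx.
rewrite -{1}rS; apply: (chart_image (G := mulmx refl3)).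
- by move=> p q f pf; exact: polymap_mull.
- by apply: (@polymap_mull _ 3 3 3 3 _ id); exact: polymap_id.
- by move=> x; rewrite mulmxA refl3K mul1mx.
- by move=> x; rewrite mulmxA refl3K mul1mx.
- exact: chH.
Qed.
End UnimodularStabilizers.

(** * Fibers of the unimodular part *)

Section Fibers.
Context {R : realType}.
Implicit Types (C M S D g : 'M[R]_3) (a b c d h eps : R).

Definition fiberII (x : 'rV[R]_2) : 'M[R]_3 :=
  mx3 [:: [:: 1; x 0 1; - x 0 0]; [:: - x 0 1; 0; 0]; [:: x 0 0; 0; 0]].

Lemma fiberIIE x : fiberII x = bII + jmap (\row_j [:: 0; x 0 0; x 0 1]`_j).
Proof.
by rewrite bIIE; apply: mx3P; rewrite !(jmapE, mxE) ?ord3DE ?ord3_eqE /=; split; ring.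
Qed.

Lemma unimod_fiberII x : unimod (fiberII x) = bII.
Proof. by rewrite unimodE bIIE; apply: mx3P; rewrite !mxE /=; split; field. Qed.

Lemma nu_of_fiberII x : nu_of (fiberII x) = \row_j [:: 0; x 0 0; x 0 1]`_j.
Proof.
by apply/rowP; apply: ord3P; rewrite nu_ofE !mxE ?ord3DE /=; field.
Qed.

(** For S = e1 e1^T the Jacobi condition says that the first coordinate of nu is zero; type IV
    excludes nu = 0. *)
Lemma unimod_fiber_bII : GLorbit bIV `&` unimod @^-1` [set bII] =
  fiberII @` [set x : 'rV[R]_2 | x 0 0 ^+ 2 + x 0 1 ^+ 2 != 0].
Proof.
have cof0 : cof3 (bII : 'M[R]_3) = 0.
  by rewrite bIIE cof3_bstd mul1r expr0n addr0 scale0r.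
have bII0 : bII != 0 :> 'M[R]_3 by rewrite bIIE; exact: bstd100_neq0.
rewrite GLorbit_IV; apply/seteqP; split=> [C [[jC _ _ nu0] /= SE]|_ [x x0 <-]].
  have nu00 : nu_of C 0 0 = 0.
    have := jC; rewrite /jacobi SE bIIE => /matrixP/(_ 0 0).
    rewrite mxE sum3E [bstd _ _ _ _ _]mxE [(nu_of C)^T _ _]mxE ![bstd _ _ _ _ _]mxE /=.
    by rewrite [RHS]mxE => <-; ring.
  pose x : 'rV[R]_2 := \row_j [:: nu_of C 0 1; nu_of C 0 2]`_j.
  have x0E : x 0 0 = nu_of C 0 1 by rewrite [LHS]mxE.
  have x1E : x 0 1 = nu_of C 0 2 by rewrite [LHS]mxE.
  have CE : C = fiberII x.
    rewrite fiberIIE [LHS]unimodK SE; congr (_ + jmap _); apply/rowP.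
    by apply: ord3P; rewrite [RHS]mxE.
  exists x => //=; rewrite x0E x1E; apply: contraNneq nu0 => /eqP.
  rewrite paddr_eq0 ?sqr_ge0 // !sqrf_eq0 => /andP[/eqP nu1 /eqP nu2].
  by apply/eqP/rowP; apply: ord3P; rewrite [RHS]mxE.
split; last exact: unimod_fiberII.
split; rewrite /jacobi ?unimod_fiberII //.
  rewrite nu_of_fiberII bIIE; apply/colP; apply: ord3P; rewrite !(mxE, sum3E) /=; ring.
apply: contraNneq x0; rewrite nu_of_fiberII => /rowP e.
by have := (e 1, e 2); rewrite !mxE /= => -[-> ->]; rewrite expr0n addr0.
Qed.

Lemma open_fiberII : open [set x : 'rV[R]_2 | x 0 0 ^+ 2 + x 0 1 ^+ 2 != 0].
Proof. by apply: open_polyfun_neq0; polyt. Qed.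

Lemma chart_unimod_fiber_bII C :
  (GLorbit bIV `&` unimod @^-1` [set bII]) C ->
  chart 2 (GLorbit bIV `&` unimod @^-1` [set bII]) C.
Proof.
apply: (@global_chart _ _ _ _ fiberII (fun M => seqrow 2 [:: M 2 0; M 0 1]) open_fiberII).
- by apply: ord3P; apply: ord3P; polyentry.
- by move=> i [[|[|//]] lj]; polyentry.
- move=> x x0; rewrite unimod_fiber_bII; split; first by exists x.
  apply/rowP => j; rewrite !mxE /=; case: j => [[|[|//]] lj] /=;
  congr (x _ _); exact: val_inj.
- rewrite unimod_fiber_bII => _ [x x0 <-].
  have -> : seqrow 2 [:: fiberII x 2 0; fiberII x 0 1] = x.
    apply/rowP => j; rewrite !mxE /=; case: j => [[|[|//]] lj] /=;
    congr (x _ _); exact: val_inj.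
  by [].
Qed.

Lemma unimod_fiber_act g : GL g ->
  GLorbit bIV `&` unimod @^-1` [set act g bII] =
  act g @` (GLorbit bIV `&` unimod @^-1` [set bII]).
Proof.
move=> gU; apply/seteqP; split=> [C [BC /= SC]|_ [C [BC /= SC] <-]]; last first.
  by split; [exact: GLorbit_act | rewrite /= unimod_act // SC].
exists (act (invmx g) C); last exact: actVK.
split; first by apply: GLorbit_act => //; exact: GLV.
by rewrite /= unimod_act ?SC ?actK //; exact: GLV.
Qed.

Lemma submanifold_unimod_fiber D : GLorbit bII D ->
  submanifold 2 (GLorbit bIV `&` unimod @^-1` [set D]).
Proof.
move=> [g gU <-]; rewrite unimod_fiber_act //.
by apply: chart_submanifold => _ [C FC <-]; apply: chart_act => //; exact: chart_unimod_fiber_bII.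
Qed.

(** The affine plane consists of all x, including x = 0, where nu vanishes and the bracket is D
    itself, of type II. Linearity of the action moves the plane from [bII] to D. *)
Lemma affine_unimod_fiber D : GLorbit bII D ->
  exists2 A, affine_subspace 2 A &
    A D /\ GLorbit bIV `&` unimod @^-1` [set D] = A `\ D.
Proof.
move=> [g gU <-]; rewrite unimod_fiber_act // unimod_fiber_bII.
have gL := act_is_linear gU.
have actD x y : act g (x + y) = act g x + act g y by have := gL 1 x y; rewrite !scale1r.
have gI : injective (act g) by move=> C C' /(congr1 (act (invmx g))); rewrite !actK.
have actZ t x : act g (t *: x) = t *: act g x.
  by have := gL t x 0; rewrite act0 // !addr0.
pose V i : 'M[R]_3 := fiberII (delta_mx 0 i) - bII.
have fE x : fiberII x = bII + (x 0 0 *: V 0 + x 0 1 *: V 1).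
  by apply: mx3P; rewrite bIIE !mxE /= ?eqxx /=; split; ring.
move: V fE => V fE.
have f0 : fiberII 0 = bII by rewrite fE !mxE !scale0r !addr0.
have finj : injective fiberII.
  move=> x y /matrixP e; have := (e 2 0, e 0 1); rewrite !mxE /= => -[e0 e1].
  by apply/rowP; apply: ord2P.
exists (act g @` range fiberII).
  exists (act g bII), [tuple act g (V 0); act g (V 1)]; split.
    apply/freeP => k; rewrite big_ord_recl big_ord_recl big_ord0 addr0 /=.
    rewrite -!actZ -actD -[RHS](act0 gU) => /gI kV.
    have /finj/rowP k0 : fiberII (\row_i k i) = fiberII 0.
      rewrite fE f0 !mxE -[RHS]addr0 -kV.
      by congr (_ + (k _ *: _ + k _ *: _)); exact: val_inj.
    by move=> i; have := k0 i; rewrite !mxE.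
  have sumE (t : 'I_2 -> R) : act g bII + \sum_(i < 2) t i *:
      tnth [tuple act g (V 0); act g (V 1)] i = act g (fiberII (\row_i t i)).
    rewrite big_ord_recl big_ord_recl big_ord0 addr0 /= fE !mxE !actD !actZ.
    by congr (_ + (t _ *: _ + t _ *: _)); exact: val_inj.
  apply/seteqP; split=> [_ [_ [x _ <-] <-]|_ [t _ <-]].
    exists (x 0) => //; rewrite sumE; congr (act g (fiberII _)).
    by apply/rowP => i; rewrite mxE.
  by rewrite sumE; exists (fiberII (\row_i t i)) => //; exists (\row_i t i).
have x0P (x : 'rV[R]_2) : x 0 0 ^+ 2 + x 0 1 ^+ 2 != 0 <-> x <> 0.
  split=> [x0 xE|x0]; first by move: x0; rewrite xE !mxE expr0n addr0 eqxx.
  apply/eqP; apply: contra_not x0 => /eqP; rewrite paddr_eq0 ?sqr_ge0 // !sqrf_eq0.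
  by move=> /andP[/eqP ? /eqP ?]; apply/rowP; apply: ord2P; rewrite mxE.
split; first by exists bII => //; exists 0.
apply/seteqP; split=> [_ [_ [x /x0P x0 <-] <-]|_ [[_ [x _ <-] <-] gx]].
  split; first by exists (fiberII x) => //; exists x.
  by rewrite /= -f0 => /gI/finj.
exists (fiberII x) => //; exists x => //; apply/x0P => xE.
by apply: gx; rewrite /= xE f0.
Qed.

End Fibers.

(** * The union of the orbits of type VII_h *)

Section UnionVII.
Context {R : realType}.
Implicit Types (C M S D g : 'M[R]_3) (a b c d h eps : R).

Definition VII_all : set 'M[R]_3 :=
  \bigcup_(h in [set h : R | 0 < h]) GLorbit (bstd 1 1 h).

Lemma VII_allE : VII_all = [set C | [/\ jacobi C, nu_of C != 0 &
  exists2 h, 0 < h & (nu_of C)^T *m nu_of C = h ^+ 2 *: cof3 (unimod C)]].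
Proof.
have e2 : (1 : R) ^+ 2 = 1 by rewrite expr1n.
apply/seteqP; split=> [C [h /= h0]|C [jC nu0 [h h0 nuE]]].
  by rewrite GLorbit_rank2 // ?lt0r_neq0 // mul1r => -[jC nu0 nuE]; split=> //; exists h.
by exists h => //=; rewrite GLorbit_rank2 // ?lt0r_neq0 // mul1r.
Qed.

Lemma act_VII_all g : GL g -> act g @` VII_all = VII_all.
Proof.
move=> gU; apply/seteqP; split=> [_ [C [h h0 BC] <-]|C [h h0 BC]].
  by exists h => //; exact: GLorbit_act.
exists (act (invmx g) C); last exact: actVK.
by exists h => //; apply: GLorbit_act => //; exact: GLV.
Qed.

(* The inverse of C |-> (p, q, r, b1, b2, t), where [[p, q], [q, r]] is the upper
   left block of unimod C and nu_of C = t (b1, b2, 1).  As nu_of C spans the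
   kernel of unimod C, these six numbers determine C when t <> 0. *)
Definition chartVII p q r b1 b2 t : 'M[R]_3 :=
  let s02 := - (p * b1 + q * b2) in let s12 := - (q * b1 + r * b2) in
  mx3 [:: [:: p; q + t; s02 - t * b2]; [:: q - t; r; s12 + t * b1];
          [:: s02 + t * b2; s12 - t * b1; - (s02 * b1 + s12 * b2)]].

Section ChartVII.
Variables p q r b1 b2 t : R.
Let s02 := - (p * b1 + q * b2).
Let s12 := - (q * b1 + r * b2).

Lemma nu_of_chartVII : nu_of (chartVII p q r b1 b2 t) = t *: \row_j [:: b1; b2; 1]`_j.
Proof. by apply/rowP; apply: ord3P; rewrite nu_ofE !mxE ?ord3DE /=; field. Qed.

Lemma unimod_chartVII : unimod (chartVII p q r b1 b2 t) =
  mx3 [:: [:: p; q; s02]; [:: q; r; s12]; [:: s02; s12; - (s02 * b1 + s12 * b2)]].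
Proof.
by rewrite unimodE /s02 /s12; apply: mx3P; rewrite !mxE /=; split; field.
Qed.

Lemma chartVII_VII_all : t != 0 -> 0 < p * r - q ^+ 2 ->
  VII_all (chartVII p q r b1 b2 t).
Proof.
move=> t0 d0; rewrite VII_allE /=; split.
- rewrite /jacobi nu_of_chartVII unimod_chartVII; apply/colP; apply: ord3P;
  rewrite !(mxE, sum3E) /= /s02 /s12; ring.
- rewrite nu_of_chartVII scaler_eq0 (negPf t0); apply/eqP => /rowP/(_ 2).
  by rewrite !mxE /=; exact/eqP/oner_neq0.
(* With b = (b1, b2, 1), nu = t b and cof S = d b^T b, so h^2 must be t^2 / d. *)
- set d := _ - _ in d0; exists (`|t| / Num.sqrt d).
    by rewrite divr_gt0 ?normr_gt0 ?sqrtr_gt0.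
  rewrite exprMn exprVn sqr_sqrtr ?(ltW d0) // -normrX ger0_norm ?sqr_ge0 //.
  have cofE : cof3 (unimod (chartVII p q r b1 b2 t)) =
      d *: ((\row_j [:: b1; b2; 1]`_j)^T *m (\row_j [:: b1; b2; 1]`_j)).
    rewrite unimod_chartVII.
    apply: mx3P; rewrite !(mxE, big_ord1) ?ord3DE /=; split; rewrite /d /s02 /s12; ring.
  rewrite cofE scalerA divfK ?lt0r_neq0 // nu_of_chartVII [(_ *: _)^T]linearZ /=.
  by rewrite -scalemxAl -scalemxAr scalerA -expr2.
Qed.
End ChartVII.

Lemma chartVIIK C : jacobi C -> nu_of C 0 2 != 0 ->
  chartVII (unimod C 0 0) (unimod C 0 1) (unimod C 1 1)
    (nu_of C 0 0 / nu_of C 0 2) (nu_of C 0 1 / nu_of C 0 2) (nu_of C 0 2) = C.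
Proof.
move=> jC t0.
have Sx k l : unimod C k l = unimod C l k by rewrite -{1}tr_unimod mxE.
have SE i : unimod C i 2 = - (unimod C i 0 * (nu_of C 0 0 / nu_of C 0 2) +
    unimod C i 1 * (nu_of C 0 1 / nu_of C 0 2)).
  have := jC; rewrite /jacobi => /matrixP/(_ i 0); rewrite mxE sum3E.
  rewrite ![(nu_of C)^T _ _]mxE [RHS]mxE => /eqP; rewrite addrC addr_eq0 => /eqP jE.
  by apply: (mulIf t0); rewrite jE; field.
rewrite [RHS]unimodK; move: (unimod C) (nu_of C) Sx SE t0 => S nu Sx SE t0.
have S02 := SE 0; have S12 := SE 1; have := SE 2.
rewrite (Sx 2 0) (Sx 2 1) S02 S12 (Sx 1 0) => S22.
apply: mx3P; rewrite !(jmapE, mxE) ?ord3DE ?ord3_eqE /=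
  ?(Sx 2 0) ?(Sx 2 1) ?(Sx 1 0) ?S22 ?S02 ?S12 ?(Sx 1 0); split; field; by [].
Qed.

Definition coordVII C : 'rV[R]_6 := seqrow 6
  [:: unimod C 0 0; unimod C 0 1; unimod C 1 1;
      nu_of C 0 0 / nu_of C 0 2; nu_of C 0 1 / nu_of C 0 2; nu_of C 0 2].

Lemma coordVII_differentiable C : nu_of C 0 2 != 0 -> differentiable coordVII C.
Proof.
move=> t0; apply: differentiable_mx => i j.
have dS k l : differentiable (fun M : 'M[R]_3 => unimod M k l) C.
  exact/polyfun_differentiable/polyfun_unimod.
have dnu k : differentiable (fun M : 'M[R]_3 => nu_of M 0 k) C.
  exact/polyfun_differentiable/polyfun_nu_of.
have dq k : differentiable (fun M : 'M[R]_3 => nu_of M 0 k / nu_of M 0 2) C.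
  by apply: differentiableM => //; exact: differentiableV.
rewrite (_ : (fun M => _) = nth (fun=> 0) [:: (fun M => unimod M 0 0);
  (fun M => unimod M 0 1); (fun M => unimod M 1 1);
  (fun M => nu_of M 0 0 / nu_of M 0 2); (fun M => nu_of M 0 1 / nu_of M 0 2);
  (fun M => nu_of M 0 2)] j).
  by case: j => [[|[|[|[|[|[|//]]]]]] lj] /=.
by apply/funext => M; rewrite mxE; case: j => [[|[|[|[|[|[|//]]]]]] lj].
Qed.

(** At this base point nu = h e3^*, so the third coordinate of nu is nonzero nearby; the group then
    moves the chart over the whole union. *)
Lemma chart_bVII h : 0 < h -> chart 6 VII_all (bstd 1 1 h).
Proof.
move=> h0.
exists [set C | nu_of C 0 2 != 0],
  ([set x : 'rV[R]_6 | x 0 5 != 0] `&` [set x | 0 < x 0 0 * x 0 2 - x 0 1 ^+ 2]),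
  (fun x => chartVII (x 0 0) (x 0 1) (x 0 2) (x 0 3) (x 0 4) (x 0 5)), coordVII.
split; split.
- by apply: open_polyfun_neq0; exact: polyfun_nu_of.
- by rewrite /= nu_of_bstd !mxE /= mulr1 lt0r_neq0.
- by apply: openI; [apply: open_polyfun_neq0 | apply: open_polyfun_gt0]; polyt.
- by apply: ord3P; apply: ord3P; polyentry.
- move=> x [/= t0 _]; apply: coordVII_differentiable.
  by rewrite nu_of_chartVII !mxE mulr1.
- move=> x [/= t0 d0]; split; first exact: chartVII_VII_all.
    by rewrite /= nu_of_chartVII !mxE mulr1.
  rewrite /coordVII nu_of_chartVII unimod_chartVII; apply/rowP => j.
  have xE k : x 0 k = seqrow 6 [:: x 0 0; x 0 1; x 0 2; x 0 3; x 0 4; x 0 5] 0 k.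
    rewrite mxE; case: k => [[|[|[|[|[|[|//]]]]]] lk] /=; congr (x _ _); exact: val_inj.
  rewrite [RHS]xE; congr (seqrow _ _ _ _); rewrite !mxE /= mulr1.
  by rewrite ![x 0 5 * _]mulrC !mulfK.
- move=> C; rewrite VII_allE => -[jC nu0 [k k0 nuE]] /= t0.
  have CE : chartVII (coordVII C 0 0) (coordVII C 0 1) (coordVII C 0 2)
      (coordVII C 0 3) (coordVII C 0 4) (coordVII C 0 5) = C.
    by rewrite /coordVII ![seqrow _ _ _ _]mxE /= chartVIIK.
  split=> //; rewrite /coordVII ![seqrow _ _ _ _]mxE; split=> //=.
  (* The last diagonal entry of the relation is nu_2^2 = k^2 (p r - q^2), whence the positivity
     required by the domain. *)
  have := nuE => /matrixP/(_ 2 2); rewrite [LHS]mxE big_ord1 [X in X * _]mxE.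
  rewrite [RHS]mxE [X in _ = _ * X]mxE !ord3DE.
  rewrite -{4}tr_unimod [(unimod C)^T _ _]mxE -!expr2 => e.
  have : 0 < nu_of C ord0 2 ^+ 2 by rewrite exprn_even_gt0.
  by rewrite e pmulr_rgt0 // exprn_gt0.
Qed.

Lemma submanifold_VII_all : submanifold 6 VII_all.
Proof.
apply: chart_submanifold => C [h /= h0 [g gU <-]].
by rewrite -(act_VII_all gU); apply: chart_act => //; exact: chart_bVII.
Qed.

End UnionVII.

(** * Group isomorphisms, cosets and irreducibility *)

Section Isos.
Context {R : realType}.
Implicit Types (C M S D g : 'M[R]_3) (K : set 'M[R]_2) (a b c d h eps : R).

Lemma top_group_iso_affmx K :
  top_group_iso (affmx @` sdprod_set K) mulmx (sdprod_set K) (@sdprod_mul R 2).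
Proof.
exists affpart; split; last first.
  by move=> _ _ [x _ <-] [y _ <-]; rewrite affmxM !affmxK.
split.
  apply: continuous_within_at => g _.
  have c1 : {for g, continuous (fun M => (affpart M).1)}.
    apply: cvg_mx_entries => i j.
    rewrite (_ : (fun M => _) = fun M : 'M[R]_3 => M (lshift 1 i) (lshift 1 j)).
      exact: coord_continuous.
    by apply/funext => M; rewrite !mxE.
  have c2 : {for g, continuous (fun M => (affpart M).2)}.
    apply: cvg_mx_entries => i j.
    rewrite (_ : (fun M => _) = fun M : 'M[R]_3 => M (lshift 1 i) (rshift 2 j)).
      exact: coord_continuous.
    by apply/funext => M; rewrite !mxE.
  exact: (cvg_pair c1 c2).
exists affmx; split=> [|_ [x Kx <-]|x Kx]; rewrite ?affmxK //.
apply: continuous_within_at => x _; apply: cvg_mx_entries => i j.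
rewrite /affmx; case: (@split_ordP 2 1 i) => k ->; case: (@split_ordP 2 1 j) => l ->.
- rewrite (_ : (fun x => _) = (fun M : 'M[R]_2 => M k l) \o fst); last first.
    by apply/funext => y /=; rewrite (@block_mxEul _ 2 1 2 1).
  by apply: continuous_comp; [exact: cvg_fst | exact: coord_continuous].
- rewrite (_ : (fun x => _) = (fun M : 'cV[R]_2 => M k l) \o snd); last first.
    by apply/funext => y /=; rewrite (@block_mxEur _ 2 1 2 1).
  by apply: continuous_comp; [exact: cvg_snd | exact: coord_continuous].
- rewrite (_ : (fun x => _) = fun=> 0); first exact: cvg_cst.
  by apply/funext => y /=; rewrite (@block_mxEdl _ 2 1 2 1) mxE.
- rewrite (_ : (fun x => _) = fun=> (1%:M : 'M[R]_1) k l); first exact: cvg_cst.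
  by apply/funext => y /=; rewrite (@block_mxEdr _ 2 1 2 1).
Qed.

Definition affine_map n (x : 'M[R]_n * 'cV[R]_n) : 'cV[R]_n -> 'cV[R]_n :=
  fun v => x.1 *m v + x.2.

Lemma affine_map_inj n : injective (@affine_map n).
Proof.
move=> [A c] [B d] e; have E v : A *m v + c = B *m v + d := congr1 (fun f => f v) e.
have cd : c = d by have := E 0; rewrite !mulmx0 !add0r.
congr (_, _) => //; apply/matrixP => i j.
by have := E (delta_mx j 0); rewrite cd => /addIr; rewrite -!colE => /colP/(_ i); rewrite !mxE.
Qed.

Lemma affine_mapM n (x y : 'M[R]_n * 'cV[R]_n) :
  affine_map (sdprod_mul x y) = affine_map x \o affine_map y.
Proof. by apply/funext => v; rewrite /affine_map /= mulmxDr mulmxA addrAC addrA. Qed.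

Lemma AffE n : @Aff R n = @affine_map n @` sdprod_set (@GL R n).
Proof.
apply/seteqP; split=> [_ [A [c [AU ->]]]|_ [[A c] [AU _] <-]]; last by exists A, c.
by exists (A, c).
Qed.

Lemma group_iso_affmx_Aff : group_iso (affmx @` sdprod_set (@GL R 2)) mulmx
  (@Aff R 2) (fun f f' => f \o f').
Proof.
exists (@affine_map 2 \o affpart); split; last first.
  by move=> _ _ [x _ <-] [y _ <-]; rewrite affmxM /= !affmxK affine_mapM.
rewrite AffE; split.
- by move=> _ [x Kx <-]; exists x; rewrite //= affmxK.
- by move=> _ _ /set_mem[x _ <-] /set_mem[y _ <-] /affine_map_inj; rewrite !affmxK => ->.
- by move=> _ [x Kx <-]; exists (affmx x); [exists x | rewrite /= affmxK].
Qed.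

Lemma group_iso_Aff_sdprod n : group_iso (@Aff R n) (fun f f' => f \o f')
  (sdprod_set (@GL R n)) (@sdprod_mul R n).
Proof.
(* The default value occurs only at maps that are not of the form [affine_map x]. *)
pose inv (f : 'cV[R]_n -> 'cV[R]_n) : 'M[R]_n * 'cV[R]_n :=
  xget (0, 0) [set x | affine_map x = f].
have invK : cancel (@affine_map n) inv.
  move=> x; rewrite /inv; case: xgetP => [y _ /affine_map_inj//|/(_ x)]; by case.
exists inv; rewrite AffE; split; last first.
  by move=> _ _ [x _ <-] [y _ <-]; rewrite -affine_mapM !invK.
split.
- by move=> _ [x Kx <-]; rewrite invK.
- by move=> _ _ /set_mem[x _ <-] /set_mem[y _ <-]; rewrite !invK => ->.
- by move=> x Kx; exists (affine_map x); [exists x | rewrite invK].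
Qed.

Lemma left_cosets_refl3 C (C' : 'M[R]_3) : Stab C' = Stab C `|` mulmx refl3 @` Stab C ->
  ~ Stab C refl3 -> (left_cosets (Stab C) (Stab C') #= `I_2)%card.
Proof.
move=> KE nr; set H := Stab C in KE nr *.
have [_ H1 HM HV] : is_subgroup H H by exact: Stab_subgroup.
have HE g : H g -> mulmx g @` H = H.
  move=> Hg; apply/seteqP; split=> [_ [x Hx <-]|x Hx]; first exact: HM.
  have gU : g \in unitmx by case: Hg.
  by exists (invmx g *m x); [apply: HM => //; exact: HV | rewrite mulmxA mulmxV // mul1mx].
have rHE g : H g -> mulmx (refl3 *m g) @` H = mulmx refl3 @` H.
  move=> Hg; rewrite -[in RHS](HE g Hg); apply/seteqP; split=> [_ [x Hx <-]|].
    by exists (g *m x); [exists x | rewrite mulmxA].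
  by move=> _ [_ [x Hx <-] <-]; exists x => //; rewrite mulmxA.
have rH : mulmx refl3 @` H <> H.
  by move=> rH; apply: nr; rewrite -rH; exists 1%:M; rewrite ?mulmx1.
have cosE : left_cosets H (Stab C') = [set H; mulmx refl3 @` H].
  rewrite /left_cosets KE; apply/seteqP; split=> [_ [g [Hg|[k Hk <-]] <-]|_ [->|->]].
  - by left; exact: HE.
  - by right; exact: rHE.
  - by exists 1%:M; [left | exact: HE].
  - exists (refl3 *m 1%:M); last exact: rHE.
    by right; exists 1%:M.
rewrite cosE; apply/card_set_bijP.
exists (fun X => if `[< X = H >] then 0%N else 1%N); split.
- by move=> X _ /=; case: ifP.
- move=> _ _ /set_mem[->|->] /set_mem[->|->] //; case: asboolP => //; case: asboolP => //.
- move=> [|[|//]] _.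
    by exists H; [left | case: asboolP].
  by exists (mulmx refl3 @` H); [right | case: asboolP].
Qed.

(** The nonzero elements of [W2] form the single orbit of [bV], so a submodule with one nonzero
    element contains them all. *)
Lemma irreducible_W2 : irreducible_submodule (@W2 R).
Proof.
have W2P C : W2 C <-> unimod C = 0 by rewrite W2E.
have uD C D t : unimod C = 0 -> unimod D = 0 -> unimod (t *: C + D) = 0.
  rewrite !unimodE => C0 D0.
  have -> : t *: C + D + (t *: C + D)^T = t *: (C + C^T) + (D + D^T).
    by apply/matrixP => i j; rewrite !mxE; ring.
  by rewrite scalerDr D0 addr0 scalerA mulrC -scalerA C0 scaler0.
have u0 : unimod (0 : 'M[R]_3) = 0 by rewrite unimodE trmx0 addr0 scaler0.
split.
- split; first exact/W2P.
  + by move=> x y /W2P x0 /W2P y0; apply/W2P; rewrite -[x]scale1r uD.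
  + by move=> t x /W2P x0; apply/W2P; rewrite -[t *: x]addr0 uD.
  + by move=> g x gU /W2P x0; apply/W2P; rewrite unimod_act // x0 act0.
- move=> W0; have : W2 (bV : 'M[R]_3).
    by have := GLorbit_refl (bV : 'M[R]_3); rewrite GLorbit_V => -[bV0 _]; apply/W2P.
  rewrite W0 => bV0; have := GLorbit_refl (bV : 'M[R]_3).
  by rewrite GLorbit_V => -[_]; rewrite bV0 -jmap0 nu_of_jmap eqxx.
- move=> S [S0 _ _ Sact] SW2; have [S0E|/existsNP[C /not_implyP[SC /eqP C0]]] :=
    pselect (forall C, S C -> C = 0).
    by left; apply/seteqP; split=> [C /S0E//|_ ->].
  right; apply/seteqP; split=> // D WD.
  have nuC : nu_of C != 0.
    have /W2P C0' := SW2 _ SC; apply: contraNneq C0 => nu0.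
    by rewrite [C]unimodK C0' nu0 jmap0 addr0.
  have [->//|D0] := eqVneq D 0.
  have nuD : nu_of D != 0.
    have /W2P D0' := WD; apply: contraNneq D0 => nu0.
    by rewrite [D]unimodK D0' nu0 jmap0 addr0.
  have [g gU gC] : GLorbit bV C by rewrite GLorbit_V; split=> //; exact/W2P/SW2.
  have [k kU <-] : GLorbit bV D by rewrite GLorbit_V; split=> //; exact/W2P.
  have -> : bV = act (invmx g) C by rewrite -gC actK.
  by apply: (Sact) => //; apply: (Sact) => //; exact: GLV.
Qed.

Lemma Stab_bIVE : Stab bIV = [set g : 'M[R]_3 | exists mu h1 h2 h3 : R, mu != 0 /\
  g = mx3 [:: [:: mu; h1; h2]; [:: 0; mu; h3]; [:: 0; 0; 1]]].
Proof.
apply/seteqP; split=> [g /Stab_bIV_coord[[g20 g21 g22] [g10 g11 g00]]|].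
  exists (g 0 0), (g 0 1), (g 0 2), (g 1 2); split=> //.
  by apply: mx3P; rewrite !mxE.
by move=> _ [mu [h1 [h2 [h3 [mu0 ->]]]]]; rewrite Stab_bIV_coord !mxE.
Qed.

Lemma confdet_diag2_00 : confdet (diag2 0 0 : 'M[R]_2) = @GL R 2.
Proof.
have d0 : diag2 0 0 = 0 :> 'M[R]_2.
  by apply/matrixP => i j; rewrite !mxE; elim/ord2P: i; elim/ord2P: j.
apply/seteqP; split=> [A []//|A AU]; split=> //.
by rewrite d0 mulmx0 mul0mx scaler0.
Qed.

Lemma eta2E : eta2 = diag2 1 1 :> 'M[R]_2.
Proof. by apply/matrixP; apply: ord2P; apply: ord2P; rewrite !mxE. Qed.

End Isos.

(** * The double cover by the unimodular part *)

Section Covering.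
Context {R : realType}.
Implicit Types (C D y : 'M[R]_3) (h eps s : R).

(* On the sheet where nu_of C 0 i has the sign s, nu_of C is determined by
   (nu_of C)^T *m nu_of C = (eps * h ^+ 2) *: cof3 (unimod C). *)
Definition sheet_nu eps h s (i : 'I_3) D : 'rV[R]_3 :=
  (s * `|h| / Num.sqrt (eps * cof3 (unimod D) i i)) *: (eps *: row i (cof3 (unimod D))).

Lemma sheet_nuE eps h s i D j : sheet_nu eps h s i D 0 j =
  s * `|h| / Num.sqrt (eps * cof3 (unimod D) i i) * (eps * cof3 (unimod D) i j).
Proof. by rewrite mxE; congr (_ * _); rewrite mxE; congr (_ * _); rewrite mxE. Qed.

Definition sheet_inv eps h s i D : 'M[R]_3 := unimod D + jmap (sheet_nu eps h s i D).

Lemma unimod_unimod C : unimod (unimod C) = unimod C.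
Proof. by rewrite [LHS]unimod_nu0 // nu_of_unimod. Qed.

Lemma sheet_inv_continuous eps h s i D : 0 < eps * cof3 (unimod D) i i ->
  {for D, continuous (sheet_inv eps h s i)}.
Proof.
move=> c0; 
have polc k l : {for D, continuous (fun M : 'M[R]_3 => cof3 (unimod M) k l)}.
  exact: (polyfun_continuous (polyfun_cof3_unimod k l)).
have nuc j : {for D, continuous (fun M => sheet_nu eps h s i M 0 j)}.
  rewrite (_ : (fun M => _) = fun M : 'M[R]_3 =>
    s * `|h| / Num.sqrt (eps * cof3 (unimod M) i i) * (eps * cof3 (unimod M) i j)).
    apply: continuousM; last by apply: continuousM => //; exact: cst_continuous.
    apply: continuousM; first exact: cst_continuous.
    apply: continuousV; first by rewrite lt0r_neq0 // sqrtr_gt0.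
    apply: (@continuous_comp _ _ _ (fun M : 'M[R]_3 => eps * cof3 (unimod M) i i) Num.sqrt).
      by apply: continuousM => //; exact: cst_continuous.
    exact: sqrt_continuous.
  by apply/funext => M; rewrite sheet_nuE.
apply: cvg_mx_entries => k l.
rewrite (_ : (fun M => _) = fun M : 'M[R]_3 => unimod M k l +
  (sheet_nu eps h s i M 0 (l + 1) * (k == l + 2)%:R -
   sheet_nu eps h s i M 0 (l + 2) * (k == l + 1)%:R)).
  apply: continuousD; first exact: (polyfun_continuous (polyfun_unimod k l)).
  by apply: continuousB; apply: continuousM => //; exact: cst_continuous.
by apply/funext => M; rewrite /sheet_inv mxE jmapE.
Qed.

(** Near y some index i satisfies eps (cof S)_ii > 0. On brackets over that open set this number is
    nu_i^2 / h^2, so nu_i does not vanish and its sign separates the two sheets. *)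
Lemma covering_rank2 eps h : eps ^+ 2 = 1 -> h != 0 ->
  covering 2 (GLorbit (bstd 1 eps h)) (GLorbit (bstd 1 eps 0)) (@unimod R).
Proof.
move=> e2 h0; have e0 : eps != 0.
  by apply: contra_eq_neq e2 => ->; rewrite expr0n /= eq_sym oner_neq0.
have h2 : 0 < h ^+ 2 by rewrite exprn_even_gt0.
have h2E : `|h| ^+ 2 = h ^+ 2 by rewrite -normrX ger0_norm ?sqr_ge0.
split=> [C /GLorbit_unimod|y By]; first by rewrite bstd_unimod.
have [nuy [n n0 nE]] : nu_of y = 0 /\
    exists2 n : 'cV_3, n != 0 & eps *: cof3 (unimod y) = n *m n^T.
  by move: By; rewrite GLorbit_rank2_unimod.
have [i ni] : exists i, n i 0 != 0.
  apply: contrapT => /forallNP k; move/eqP: n0; apply; apply/colP => i.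
  by move/negP/negPn/eqP: (k i) => ->; rewrite mxE.
have AE C : GLorbit (bstd 1 eps h) C -> forall k l,
    eps * cof3 (unimod C) k l = (nu_of C 0 k * nu_of C 0 l) / h ^+ 2.
  rewrite GLorbit_rank2 // => -[_ _ /matrixP nuE] k l.
  have := nuE k l; rewrite [LHS]mxE big_ord1 [X in X * _]mxE [RHS]mxE => ->.
  by rewrite mulrAC mulfK // lt0r_neq0.
exists [set D | 0 < eps * cof3 (unimod D) i i],
  (fun b : 'I_2 => GLorbit (bstd 1 eps h) `&` [set C | 0 < (-1) ^+ b * nu_of C 0 i]).
have AO C : GLorbit (bstd 1 eps h) C ->
    (0 < eps * cof3 (unimod C) i i) = (nu_of C 0 i != 0).
  move=> AC; rewrite AE // -expr2 pmulr_lgt0 ?invr_gt0 //.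
  by rewrite exprn_even_gt0.
split.
- by apply: open_polyfun_gt0; polyt; exact: polyfun_cof3_unimod.
- rewrite /=; have /matrixP/(_ i i) := nE; rewrite mxE => ->.
  by rewrite !(mxE, big_ord1) -expr2 exprn_even_gt0.
- apply/seteqP; split=> [C [AC /= ]|C [b _ [AC /= sb]]].
    rewrite unimod_unimod AO // neq_lt => /orP[nu0|nu0].
      by exists 1 => //; split=> //=; rewrite expr1 mulN1r oppr_gt0.
    by exists 0 => //; split=> //=; rewrite expr0 mul1r.
  split=> //=; rewrite unimod_unimod AO //.
  by apply: contraTneq sb => ->; rewrite mulr0 ltxx.
- move=> b c bc; apply/seteqP; split=> // C [[_ /= sb] [_ /= sc]].
  move: bc sb sc; elim/ord2P: b; elim/ord2P: c => //= _; rewrite !expr0 !expr1 mul1r mulN1r oppr_gt0 => x1 x2;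
  by have := lt_trans x1 x2; rewrite ltxx.
move=> b; split.
  exists [set C | 0 < (-1) ^+ b * nu_of C 0 i] => //.
  by apply: open_polyfun_gt0; polyt; exact: polyfun_nu_of.
split.
  apply: continuous_within_at => C _; apply: cvg_mx_entries => k l.
  exact: (polyfun_continuous (polyfun_unimod k l)).
set s : R := (-1) ^+ b; have s2 : s ^+ 2 = 1 by rewrite sqrr_sign.
have s1 : `|s| = 1 by rewrite normr_sign.
exists (sheet_inv eps h s i); split.
- by apply: continuous_within_at => D [_ DO]; exact: sheet_inv_continuous.
- move=> C [AC /= sC]; have nui : nu_of C 0 i != 0.
    by apply: contraTneq sC => ->; rewrite mulr0 ltxx.
  split.
    split; first by move/GLorbit_unimod: AC; rewrite bstd_unimod.
    by rewrite /= unimod_unimod AO.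
  rewrite /sheet_inv unimod_unimod [RHS]unimodK; congr (_ + jmap _).
  apply/rowP => j; rewrite sheet_nuE unimod_unimod !AE //.
  have sE : `|nu_of C 0 i| = s * nu_of C 0 i.
    by rewrite -[LHS]mul1r -s1 -normrM gtr0_norm.
  have -> : Num.sqrt (nu_of C 0 i * nu_of C 0 i / h ^+ 2) = `|nu_of C 0 i| / `|h|.
    by rewrite -expr2 -expr_div_n sqrtr_sqr normrM normfV.
  rewrite sE; have nh0 : `|h| != 0 by rewrite normr_eq0.
  have s0 : s != 0 by rewrite -normr_gt0 s1.
  (* To [field] the values |h| and h are unrelated, so their quotient is isolated and simplified by
     hand. *)
  transitivity (nu_of C 0 j * (`|h| ^+ 2 / h ^+ 2)); last by rewrite h2E mulfV ?mulr1 // lt0r_neq0.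
  by field; rewrite h0 nh0 s0 nui.
- move=> D [BD /= DO]; have := BD; rewrite GLorbit_rank2_unimod // => -[nuD [m m0 mE]].
  have mEe k l : eps * cof3 (unimod D) k l = m k 0 * m l 0.
    by have /matrixP/(_ k l) := mE; rewrite mxE => ->; rewrite !(mxE, big_ord1).
  have mi : m i 0 != 0 by move: DO; rewrite mEe -expr2 exprn_even_gt0.
  (* The vector m is determined only up to sign; the factor m_i / |m_i| makes lam m^T independent of
     that choice and gives its coordinate i the sign s. *)
  set lam := s * `|h| * m i 0 / `|m i 0|.
  have lam2 : lam ^+ 2 = h ^+ 2.
    rewrite /lam !exprMn exprVn s2 mul1r h2E -[`|m i 0| ^+ 2]normrX ger0_norm ?sqr_ge0 //.
    by rewrite mulfK // expf_neq0.
  have nuE : sheet_nu eps h s i D = lam *: m^T.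
    apply/rowP => j; rewrite sheet_nuE !mEe -expr2 sqrtr_sqr.
    by rewrite !mxE /lam; ring.
  have nuE' : nu_of (sheet_inv eps h s i D) = lam *: m^T.
    by rewrite nu_ofD nu_of_unimod nu_of_jmap add0r.
  have SE : unimod (sheet_inv eps h s i D) = D.
    by rewrite /unimod nuE' /sheet_inv nuE addrK unimod_nu0.
  have lam0 : lam != 0 by rewrite -sqrf_eq0 lam2 sqrf_eq0.
  split=> //; split=> /=.
    rewrite GLorbit_rank2 //; split.
    + rewrite /jacobi SE nuE' [(_ *: _)^T]linearZ /= trmxK -scalemxAr.
      have cE : cof3 D = eps^-1 *: (m *m m^T) by rewrite -mE scalerK // unimod_nu0.
      rewrite (cof3_rank1_ker _ cE) ?scaler0 ?invr_eq0 //.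
      by rewrite -{1}(unimod_nu0 nuD) tr_unimod unimod_nu0.
    + by rewrite nuE' scaler_eq0 (negPf lam0) trmx_neq0.
    + rewrite nuE' SE [(_ *: _)^T]linearZ /= trmxK -scalemxAl -scalemxAr scalerA.
      by rewrite -expr2 lam2 -mE unimod_nu0 // scalerA mulrC.
  rewrite nuE' !mxE /lam.
  have -> : s * (s * `|h| * m i 0 / `|m i 0| * m i 0) = s ^+ 2 * (`|h| * (m i 0 ^+ 2 / `|m i 0|)).
    by ring.
  rewrite s2 mul1r mulr_gt0 ?normr_gt0 // divr_gt0 ?normr_gt0 //.
  by rewrite exprn_even_gt0.
Qed.
End Covering.

Theorem mainTheorem4 (R : realType) :
  let B (C : 'M[R]_3) := GLorbit C in
  let BVI_all : set 'M[R]_3 := \bigcup_(h in [set h : R | h < 0]) B (bVI h) in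
  let BVII_all : set 'M[R]_3 := \bigcup_(h in [set h : R | 0 < h]) B (bVII h) in
  (* Bianchi V *)
  (is_subgroup (Stab bV) (Stab (unimod (bV : 'M[R]_3))) /\
   Stab bV = affmx @` sdprod_set (@GL R 2) /\
   group_iso (Stab (bV : 'M[R]_3)) mulmx
             (@Aff R 2) (fun f f' => f \o f') /\
   group_iso (@Aff R 2) (fun f f' => f \o f')
             (sdprod_set (@GL R 2)) (@sdprod_mul R 2) /\
   top_group_iso (Stab (bV : 'M[R]_3)) mulmx
                 (sdprod_set (@GL R 2)) (@sdprod_mul R 2) /\
   submanifold 6 (Stab (bV : 'M[R]_3)) /\
   orbit_dim (bV : 'M[R]_3) 3 /\
   closure (B bV) = B bV `|` B bI /\
   B bI = [set 0] /\
   closure (B bV) = W2 /\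
   irreducible_submodule (@W2 R))
  /\
  (* Bianchi IV *)
  (is_subgroup (Stab bIV) (Stab (unimod (bIV : 'M[R]_3))) /\
   Stab bIV = [set g : 'M[R]_3 | exists mu h1 h2 h3 : R, mu != 0 /\
                 g = mx3 [:: [:: mu; h1; h2];
                             [:: 0; mu; h3];
                             [:: 0; 0; 1]]] /\
   submanifold 4 (Stab (bIV : 'M[R]_3)) /\
   orbit_dim (bIV : 'M[R]_3) 5 /\
   orbit_dim (bII : 'M[R]_3) 3 /\
   (forall C, B bIV C -> B bII (unimod C)) /\
   (forall D, B bII D ->
      let fiber := B bIV `&` unimod @^-1` [set D] in
      submanifold 2 fiber /\
      exists2 A, affine_subspace 2 A & A D /\ fiber = A `\ D) /\
   closure (B bIV) = B bIV `|` B bII `|` B bV `|` B bI)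
  /\
  (* Bianchi VI_h *)
  ((forall h : R, h < 0 ->
      is_subgroup (Stab (bVI h)) (Stab (unimod (bVI h))) /\
      (forall h' : R, h' < 0 -> Stab (bVI h') = Stab (bVI h)) /\
      is_subgroup (Stab (bVI h)) (Stab (bVI 0)) /\
      (left_cosets (Stab (bVI h)) (Stab (bVI 0)) #= `I_2)%card /\
      Stab (bVI h) = affmx @` sdprod_set (COdet eta11) /\
      top_group_iso (Stab (bVI h)) mulmx
                    (sdprod_set (COdet (@eta11 R))) (@sdprod_mul R 2) /\
      orbit_dim (bVI h) 5 /\
      covering 2 (B (bVI h)) (B (bVI 0)) unimod /\
      closure (B (bVI h)) = B (bVI h) `|` B bII `|` B bI /\
      closure (B (bVI h)) `&` B bIV = set0 /\
      closure (B (bVI h)) `&` B bV = set0) /\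
   orbit_dim (bVI (0 : R)) 5 /\
   B bIV `<=` closure BVI_all /\
   B bV `<=` closure BVI_all /\
   B (bVI 0) `<=` closure BVI_all)
  /\
  (* Bianchi VII_h *)
  ((forall h : R, 0 < h ->
      is_subgroup (Stab (bVII h)) (Stab (unimod (bVII h))) /\
      Stab (bVII h) = affmx @` sdprod_set (COdet eta2) /\
      top_group_iso (Stab (bVII h)) mulmx
                    (sdprod_set (COdet (@eta2 R))) (@sdprod_mul R 2) /\
      orbit_dim (bVII h) 5 /\
      covering 2 (B (bVII h)) (B (bVII 0)) unimod /\
      closure (B (bVII h)) = B (bVII h) `|` B bII `|` B bI) /\
   submanifold 6 BVII_all /\
   closure BVII_all = BVII_all `|` B bII `|` B bI
                        `|` B bIV `|` B bV `|` B (bVII 0)).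
Proof.
move=> B BVI_all BVII_all.
have e1 : (1 : R) ^+ 2 = 1 by rewrite expr1n.
have eN : (-1 : R) ^+ 2 = 1 by rewrite sqrrN expr1n.
have one0 := oner_neq0 R.
have SU (C : 'M[R]_3) : is_subgroup (Stab C) (Stab (unimod C)).
  exact/Stab_subgroup/Stab_unimod.
have VE : Stab bV = affmx @` sdprod_set (@GL R 2).
  by rewrite bVE Stab_bstd // confdet_diag2_00.
(* The right side is free of h, which is why all h <> 0 share one stabilizer. *)
have rank2E (eps h : R) : h != 0 ->
    Stab (bstd 1 eps h) = affmx @` sdprod_set (COdet (diag2 1 eps)).
  by move=> h0; rewrite Stab_bstd // COdetE.
split; [|split; [|split]].
- split; first exact: SU.
  split; first exact: VE.
  split; first by rewrite VE; exact: group_iso_affmx_Aff.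
  split; first exact: group_iso_Aff_sdprod.
  split; first by rewrite VE; exact: top_group_iso_affmx.
  split; first exact: submanifold_Stab_bV.
  split; first by exists 6; [exact: submanifold_Stab_bV | ].
  split; first exact: closure_bV.
  split; first exact: GLorbit_I.
  split; first exact: closure_bV_W2.
  exact: irreducible_W2.
- split; first exact: SU.
  split; first exact: Stab_bIVE.
  split; first exact: submanifold_Stab_bIV.
  split; first by exists 4; [exact: submanifold_Stab_bIV | ].
  split; first by exists 6; [exact: submanifold_Stab_bII | ].
  split.
    by move=> C /GLorbit_unimod; rewrite bIVE bstd_unimod -bIIE.
  split; last exact: closure_bIV.
  move=> D BD; split; first exact: submanifold_unimod_fiber.
  exact: affine_unimod_fiber.
- split.
    move=> h h_lt0; have h0 : h != 0 by rewrite lt_eqF.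
    have KE : Stab (bVI 0) = Stab (bVI h) `|` mulmx (@refl3 R) @` Stab (bVI h).
      by rewrite !bVIE; exact: Stab_rank2_unimod.
    split; first exact: SU.
    split.
      by move=> h' h'_lt0; rewrite !bVIE !rank2E // lt_eqF.
    split; first by apply: Stab_subgroup; rewrite KE; exact: subsetUl.
    split.
      (* If [refl3] were an automorphism, the entry at (0, 1) would give -h = h. *)
      apply: (left_cosets_refl3 KE); rewrite bVIE => -[_].
      rewrite act_refl3 => /matrixP/(_ 0 1); rewrite !mxE /= => /eqP.
      by rewrite eq_sym -addr_eq0 -mulr2n mulrn_eq0 (negPf h0).
    split; first by rewrite bVIE rank2E.
    split; first by rewrite bVIE rank2E //; exact: top_group_iso_affmx.
    split.
      exists 4 => //; rewrite bVIE; apply: chart_submanifold => g.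
      exact: chart_Stab_rank2.
    split; first by rewrite !bVIE; exact: covering_rank2.
    split; first by rewrite /B bVIE; exact: closure_rank2.
    by rewrite /B bVIE; exact: closure_rank2_disj.
  have subVI (t : R) : 0 < t -> GLorbit (bstd 1 (-1) (-1 * t)) `<=` BVI_all.
    move=> t0 C BC; exists (- t); rewrite /= ?oppr_lt0 // /B bVIE.
    by rewrite mulN1r in BC.
  split; first by exists 4 => //; rewrite bVIE; exact: submanifold_Stab_rank2_unimod.
  split; first exact: (closure_GLorbit_IV eN subVI).
  split; first exact: (closure_GLorbit_V eN subVI).
  by rewrite /B bVIE; exact: (closure_GLorbit_rank2_unimod subVI).
- have BVIIE : BVII_all = VII_all by apply: eq_bigcupr => h _; rewrite /B bVIIE.
  split; last first.
    split; first by rewrite BVIIE; exact: submanifold_VII_all.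
    by rewrite BVIIE /B bVIIE; exact: closure_VII_all.
  move=> h h_gt0; have h0 : h != 0 by rewrite gt_eqF.
  rewrite eta2E; split; first exact: SU.
  split; first by rewrite bVIIE rank2E.
  split; first by rewrite bVIIE rank2E //; exact: top_group_iso_affmx.
  split.
    exists 4 => //; rewrite bVIIE; apply: chart_submanifold => g.
    exact: chart_Stab_rank2.
  split; first by rewrite !bVIIE; exact: covering_rank2.
  by rewrite /B bVIIE; exact: closure_rank2.
Qed.
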